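(* There is a universal constant $C>0$ such that the following holds. Let $d\ge1$, let $T\geq 110d^2$, and run the algorithm Schrödinger's-BISONS (defined in the context) for $T$ rounds with $B=\frac{264}{5}d^2\log(T)$, $\eta=\frac{1}{4B}$, $\beta=\frac{11d}{7B}$, against an arbitrary sequence of loss matrices $R_1,\dots,R_T\in\mathcal{A}$. Let $U\in\mathcal{A}$ be any comparator with $U\succeq T^{-1}\mathbf{I}_d$. Then: (1) for every epoch whose end is triggered by the reset condition, with set of rounds $\mathcal{E}$, $\sum_{t\in\mathcal{E}}(f_t(X_t)-f_t(U))\leq 0$; (2) for the epoch that runs until the end of time $T$ (without reset), with set of rounds $\mathcal{E}$, $\sum_{t\in\mathcal{E}}(f_t(X_t)-f_t(U))\leq C\,d^3\log^2(T)$.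
   Context: Quantum learning with log loss: $\mathcal{A}$ is the set of $d\times d$ complex Hermitian positive semidefinite matrices of trace $1$; $\langle X,Y\rangle=\mathrm{Tr}(XY)$; $\preceq$ is the Loewner order. In each round $t=1,\dots,T$ the learner plays $X_t\in\mathcal{A}$, then observes $R_t\in\mathcal{A}$ (arbitrary) and suffers $f_t(X_t)$ where $f_t(X)=-\log(\langle X,R_t\rangle)$. Gradients: $\nabla f_t(X)=-R_t/\langle X,R_t\rangle$. Regularizer: $R(X)=-\log\det(X)$. For a Hermitian matrix $M$, $(M)_+$ denotes its positive part (negative eigenvalues set to $0$). Schrödinger's-BISONS with inputs $T,B,\eta,\beta$ operates in epochs, the first starting at round $1$. Within an epoch there is an internal time $\tau=1,2,\dots$, and all quantities below are started afresh in each epoch. Set $P_0=d\,\mathbf{I}_d$, $X_1=U_1=\arg\min_{X\in\mathcal{A}}R(X)=\frac1d\mathbf{I}_d$, and for all $\tau\ge1$ $$P_\tau=P_{\tau-1}+X_\tau^{-1/2}\big(\mathbf{I}_d-X_\tau^{1/2}P_{\tau-1}X_\tau^{1/2}\big)_+X_\tau^{-1/2}$$ (so $P_1=d\,\mathbf{I}_d$). In the global round $t$ corresponding to internal time $\tau$ the algorithm plays $X_t=X_\tau$, receives $f_\tau:=f_t$, and forms $$\hat f_\tau(X)=f_\tau(X_\tau)+\langle X-X_\tau,\nabla f_\tau(X_\tau)\rangle+\tfrac\beta2\langle X-X_\tau,\nabla f_\tau(X_\tau)\rangle^2,\qquad g_\tau(X)=\hat f_\tau(X)-B\langle X,P_\tau-P_{\tau-1}\rangle.$$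 It then computes $$X_{\tau+1}=\arg\min_{X\in\mathcal{A}}\sum_{s=1}^\tau g_s(X)+\eta^{-1}R(X),\qquad U_{\tau+1}=\arg\min_{X\in\mathcal{A}}\sum_{s=1}^\tau\hat f_s(X)+\eta^{-1}R(X),$$ and $P_{\tau+1}$. If $U_{\tau+1}\not\prec\frac{1}{2(1+6\eta)\beta}P_{\tau+1}^{-1}$ (the reset condition, checked at internal time $\tau$), the epoch ends with round $t$ and a new epoch starts in round $t+1$; otherwise $\tau$ is increased by one and the epoch continues. *)

(* Defs.v *)
From mathcomp Require Export all_boot all_order all_algebra.
From mathcomp Require Export complex.
From mathcomp Require Export reals ereal exp.
From mathcomp Require Import sesquilinear spectral.

Set Implicit Arguments.
Unset Strict Implicit.
Unset Printing Implicit Defensive.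

Import Order.TTheory GRing.Theory Num.Theory.

Local Open Scope ring_scope.
Local Open Scope complex_scope.
Local Open Scope sesquilinear_scope.

Definition psdmx (R : realType) (d : nat) (A : 'M[R[i]]_d) : Prop :=
  A \is hermsymmx /\ forall v : 'rV[R[i]]_d, 0 <= (v *m A *m v^t*) 0 0.

Definition pdmx (R : realType) (d : nat) (A : 'M[R[i]]_d) : Prop :=
  A \is hermsymmx /\
  forall v : 'rV[R[i]]_d, v != 0 -> 0 < (v *m A *m v^t*) 0 0.

Definition loewner_le (R : realType) (d : nat) (A B : 'M[R[i]]_d) : Prop :=
  psdmx (B - A).

Definition loewner_lt (R : realType) (d : nat) (A B : 'M[R[i]]_d) : Prop :=
  pdmx (B - A).

Definition density (R : realType) (d : nat) (X : 'M[R[i]]_d) : Prop :=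
  psdmx X /\ \tr X = 1.

(* The trace is real whenever X and Y are Hermitian, so that taking the real
   part only changes the type. *)
Definition inner (R : realType) (d : nat) (X Y : 'M[R[i]]_d) : R :=
  complex.Re (\tr (X *m Y)).

(* Functional calculus: for Hermitian A = Q^* diag(l) Q, the matrix
   Q^* diag(f l) Q. *)
Definition mxfun (R : realType) (d : nat) (f : R -> R) (A : 'M[R[i]]_d) :
    'M[R[i]]_d :=
  invmx (spectralmx A)
  *m diag_mx (map_mx (fun z : R[i] => (f (complex.Re z))%:C) (spectral_diag A))
  *m spectralmx A.

Definition sqrtmx (R : realType) (d : nat) (A : 'M[R[i]]_d) : 'M[R[i]]_d :=
  mxfun (@Num.sqrt R) A.

Definition posmx (R : realType) (d : nat) (A : 'M[R[i]]_d) : 'M[R[i]]_d :=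
  mxfun (fun x : R => Num.max x 0) A.

(* f_t is described by its loss matrix Rt. With the library's convention
   ln 0 = 0, the value at inner X Rt = 0 is not the mathematical +oo, but this
   case never occurs below: losses are only evaluated at positive definite X
   (the minimizers of the log-det regularized objectives, and the
   comparator). *)
Definition loss (R : realType) (d : nat) (Rt X : 'M[R[i]]_d) : R :=
  - ln (inner X Rt).

Definition grad_loss (R : realType) (d : nat) (Rt X : 'M[R[i]]_d) :
    'M[R[i]]_d :=
  - ((inner X Rt)^-1)%:C *: Rt.

(* Extended-real valued: logdet_reg X = +oo if \det X = 0. *)
Definition logdet_reg (R : realType) (d : nat) (X : 'M[R[i]]_d) : \bar R :=
  (- lne (complex.Re (\det X))%:E)%E.

Definition surrogate (R : realType) (d : nat) (beta : R)
    (Rt Xt X : 'M[R[i]]_d) : R :=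
  let s := inner (X - Xt) (grad_loss Rt Xt) in
  loss Rt Xt + s + beta / 2 * s ^+ 2.

(* P' is the matrix preceding P, i.e., (P_{tau-1}, P_tau) = (P', P). *)
Definition biased_surrogate (R : realType) (d : nat) (B beta : R)
    (Rt Xt P' P X : 'M[R[i]]_d) : R :=
  surrogate beta Rt Xt X - B * inner X (P - P').

Definition is_argmin (R : realType) (d : nat) (F : 'M[R[i]]_d -> \bar R)
    (X : 'M[R[i]]_d) : Prop :=
  density X /\ forall Y : 'M[R[i]]_d, density Y -> (F X <= F Y)%E.

Definition update_P (R : realType) (d : nat) (P X : 'M[R[i]]_d) :
    'M[R[i]]_d :=
  let S := sqrtmx X in
  P + invmx S *m posmx (1%:M - S *m P *m S) *m invmx S.

(* An epoch consists of the global rounds start + 1, ..., start + len; the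
   internal time tau is the global round start + tau. The sequences are
   meaningful for X and U at indices 1 .. len + 1 and for P at indices
   0 .. len + 1. *)
Record epoch (R : realType) (d : nat) := Epoch {
  start : nat;
  len : nat;
  epX : nat -> 'M[R[i]]_d;
  epU : nat -> 'M[R[i]]_d;
  epP : nat -> 'M[R[i]]_d
}.

(* The reset condition checked at internal time tau. *)
Definition reset (R : realType) (d : nat) (eta beta : R) (e : epoch R d)
    (tau : nat) : Prop :=
  ~ loewner_lt (epU e tau.+1)
      (((2 * (1 + 6 * eta) * beta)^-1)%:C *: invmx (epP e tau.+1)).

Record valid_epoch (R : realType) (d : nat) (B eta beta : R)
    (Rs : nat -> 'M[R[i]]_d) (e : epoch R d) : Prop := ValidEpoch {
  epoch_len_gt0 : (0 < len e)%N;
  epoch_P0 : epP e 0%N = (d%:R)%:M;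
  epoch_X1 : is_argmin (@logdet_reg R d) (epX e 1%N);
  epoch_U1 : epU e 1%N = epX e 1%N;
  epoch_P : forall tau : nat, (1 <= tau <= (len e).+1)%N ->
    epP e tau = update_P (epP e tau.-1) (epX e tau);
  epoch_X : forall tau : nat, (1 <= tau <= len e)%N ->
    is_argmin
      (fun X => (\sum_(1 <= s < tau.+1)
          biased_surrogate B beta (Rs (start e + s)%N) (epX e s)
            (epP e s.-1) (epP e s) X)%:E
        + (eta^-1)%:E * logdet_reg X)%E
      (epX e tau.+1);
  epoch_U : forall tau : nat, (1 <= tau <= len e)%N ->
    is_argmin
      (fun X => (\sum_(1 <= s < tau.+1)
          surrogate beta (Rs (start e + s)%N) (epX e s) X)%:E
        + (eta^-1)%:E * logdet_reg X)%E
      (epU e tau.+1);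
  epoch_no_early_reset : forall tau : nat, (1 <= tau < len e)%N ->
    ~ reset eta beta e tau
}.

Definition ends_with_reset (R : realType) (d : nat) (eta beta : R)
    (e : epoch R d) : Prop :=
  reset eta beta e (len e).

(* A run over T rounds, made of the consecutive epochs E 0, ..., E n. Every
   epoch but the last is ended by a reset; the last one ends with round T,
   with or without a reset being triggered there. *)
Record bisons_run (R : realType) (d T : nat) (B eta beta : R)
    (Rs : nat -> 'M[R[i]]_d) (n : nat) (E : nat -> epoch R d) : Prop :=
  BisonsRun {
  run_start : start (E 0%N) = 0%N;
  run_valid : forall k : nat, (k <= n)%N -> valid_epoch B eta beta Rs (E k);
  run_next : forall k : nat, (k < n)%N ->
    ends_with_reset eta beta (E k) /\
    start (E k.+1) = (start (E k) + len (E k))%N;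
  run_end : (start (E n) + len (E n))%N = T
}.

Definition epoch_regret (R : realType) (d : nat) (Rs : nat -> 'M[R[i]]_d)
    (e : epoch R d) (U : 'M[R[i]]_d) : R :=
  \sum_(1 <= tau < (len e).+1)
    (loss (Rs (start e + tau)%N) (epX e tau) - loss (Rs (start e + tau)%N) U).

(* Main.v *)
(* For a loss matrix [R_s] put z_s(V) = <V, R_s> / <X_s, R_s> and
   q(z) = 1 - z + beta/2 (1 - z)^2, so that f_s(V) - f_s(X_s) = - ln z_s(V) and
   its surrogate is q(z_s(V)).  Let hatU be the last surrogate minimizer U_(tau+1).
   The absence of earlier resets and the stability of the minimizers give
   beta z_s(hatU) <= 11/20, and there the tangent of q lies below - ln on the
   whole half-line.  First-order optimality of hatU therefore bounds the regret
   against any U by the surrogate regret against hatU plus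
   (ln det hatU - ln det U) / eta, without further conditions on U.

   The surrogate regret against hatU is a follow-the-regularized-leader bound:
   the quadratic terms of the surrogates give an elliptic potential in dimension
   d^2, and the bias terms telescope into ln det P_tau - ln det P_0, up to
   - B <hatU, P_tau - P_0>.  Everything but the last term is at most
   9 B d ln T.  When a reset occurs, <hatU, P_(tau+1)> >= 1 / (2 (1 + 6 eta) beta),
   about 16.8 d ln T, and P_(tau+1) is within a constant factor close to 1 of
   P_tau, so the last term dominates.

   All stability estimates come from adding the optimality conditions of two
   consecutive minimizers X and Y, which controls
   tr (X^-1 Y) + tr (Y^-1 X) - 2 d = sum (r - 1)^2 / r, where r runs over the
   spectrum of X^-1 Y. *)

Require Import Defs.
From mathcomp Require Import boolp sesquilinear spectral ring lra.

Set Implicit Arguments.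
Unset Strict Implicit.
Unset Printing Implicit Defensive.

Import Order.TTheory GRing.Theory Num.Theory.

Local Open Scope ring_scope.
Local Open Scope complex_scope.
Local Open Scope sesquilinear_scope.

(** * Hermitian matrices *)

Lemma congr_mxB (S : comNzRingType) n (L M A B : 'M[S]_n) :
  L *m A *m M - L *m B *m M = L *m (A - B) *m M.
Proof. by rewrite -mulmxBl -mulmxBr. Qed.

Section Hermitian.
Variable R : realType.
Implicit Types (m n p : nat).

Lemma adjM m n p (A : 'M[R[i]]_(m, n)) (B : 'M[R[i]]_(n, p)) :
  (A *m B)^t* = B^t* *m A^t*.
Proof. by rewrite trmx_mul map_mxM. Qed.

Lemma adjD m n (A B : 'M[R[i]]_(m, n)) : (A + B)^t* = A^t* + B^t*.
Proof. by rewrite linearD /= map_mxD. Qed.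

Lemma adjN m n (A : 'M[R[i]]_(m, n)) : (- A)^t* = - A^t*.
Proof. by rewrite linearN /= map_mxN. Qed.

Lemma adjZ m n (a : R) (A : 'M[R[i]]_(m, n)) : (a%:C *: A)^t* = a%:C *: A^t*.
Proof. by rewrite linearZ /= map_mxZ /=; congr (_ *: _); exact: conjc_real. Qed.

Lemma hermP n (A : 'M[R[i]]_n) : A \is hermsymmx <-> A^t* = A.
Proof.
split=> [/sesquiP|hA]; first by rewrite expr0 scale1r.
by apply/sesquiP; rewrite expr0 scale1r hA.
Qed.

Definition rdiag n (r : 'I_n -> R) : 'M[R[i]]_n := diag_mx (\row_i (r i)%:C).

Lemma rdiagE n (r : 'I_n -> R) i j : rdiag r i j = (r i)%:C *+ (i == j).
Proof. by rewrite !mxE; case: eqP => [->|]. Qed.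

Lemma eq_rdiag n (r s : 'I_n -> R) : r =1 s -> rdiag r = rdiag s.
Proof. by move=> e; congr diag_mx; apply/rowP=> i; rewrite !mxE e. Qed.

Lemma rdiagM n (r s : 'I_n -> R) :
  rdiag r *m rdiag s = rdiag (fun i => r i * s i).
Proof.
rewrite mulmx_diag; congr diag_mx; apply/rowP=> i.
by rewrite !mxE rmorphM.
Qed.

Lemma rdiagB n (r s : 'I_n -> R) :
  rdiag r - rdiag s = rdiag (fun i => r i - s i).
Proof. by apply/matrixP=> i j; rewrite !mxE -mulrnBl rmorphB. Qed.

Lemma congr_rdiagB n (L M : 'M[R[i]]_n) (r s : 'I_n -> R) :
  L *m rdiag r *m M - L *m rdiag s *m M = L *m rdiag (fun i => r i - s i) *m M.
Proof. by rewrite congr_mxB rdiagB. Qed.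

Lemma rdiag_adj n (r : 'I_n -> R) : (rdiag r)^t* = rdiag r.
Proof.
apply/matrixP=> i j; rewrite mxE [in LHS]mxE !rdiagE rmorphMn /= eq_sym.
by case: eqP => [->|//]; rewrite /= ?mulr1n; exact: conjc_real.
Qed.

Lemma rdiag_const n (a : R) : rdiag (fun=> a) = a%:C%:M :> 'M[R[i]]_n.
Proof. by rewrite -diag_const_mx; congr diag_mx; apply/rowP=> i; rewrite !mxE. Qed.

Lemma det_rdiag n (r : 'I_n -> R) : \det (rdiag r) = (\prod_i r i)%:C.
Proof. by rewrite det_diag rmorph_prod; apply: eq_bigr => i _; rewrite mxE. Qed.

Lemma rdiag_unit n (r : 'I_n -> R) : (forall i, r i != 0) ->
  rdiag r \in unitmx.
Proof.
move=> r0; rewrite unitmxE det_rdiag unitfE.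
by rewrite (inj_eq (@complexI R)); apply/prodf_neq0 => i _; exact: r0.
Qed.

Lemma invmx_rdiag n (r : 'I_n -> R) : (forall i, r i != 0) ->
  invmx (rdiag r) = rdiag (fun i => (r i)^-1).
Proof.
move=> r0; rewrite -[LHS]mulmx1.
have -> : 1%:M = rdiag r *m rdiag (fun i => (r i)^-1).
  by rewrite rdiagM (@eq_rdiag _ _ (fun=> 1)) ?rdiag_const// => i; rewrite divff.
by rewrite mulKmx // rdiag_unit.
Qed.

Lemma adj_unit n (A : 'M[R[i]]_n) : (A^t* \in unitmx) = (A \in unitmx).
Proof. by rewrite map_unitmx unitmx_tr. Qed.

Lemma adj1 n : (1%:M : 'M[R[i]]_n)^t* = 1%:M.
Proof. by rewrite trmx1 map_mx1. Qed.

Lemma adj_inv n (A : 'M[R[i]]_n) : A \in unitmx -> invmx (A^t*) = (invmx A)^t*.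
Proof.
move=> uA; rewrite -[LHS]mulmx1 -(adj1 n) -(mulVmx uA) adjM mulKmx //.
by rewrite adj_unit.
Qed.

(** One unitary serves [A] and all [mxfun f A] at once, so nothing later depends on the basis that
    [spectralmx] chooses. *)
Lemma mxfun_spectral n (A : 'M[R[i]]_n) : A^t* = A ->
  exists (Q : 'M[R[i]]_n) (r : 'I_n -> R),
    [/\ Q *m Q^t* = 1%:M, A = Q^t* *m rdiag r *m Q &
      forall f : R -> R, mxfun f A = Q^t* *m rdiag (fun k => f (r k)) *m Q].
Proof.
move=> hA; have hA' : A \is hermsymmx by apply/hermP.
exists (spectralmx A), (fun i => complex.Re (spectral_diag A 0 i)).
have U := spectral_unitarymx A; split; first exact/unitarymxP.
- rewrite -(invmx_unitary U).
  have /orthomx_spectralP {1}-> := hermitian_normalmx hA'.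
  rewrite /rdiag; set v := \row_i _; suff -> : v = spectral_diag A by [].
  apply/rowP => i; rewrite mxE RRe_real//.
  by have /mxOverP := hermitian_spectral_diag_real hA'; apply.
- move=> f; rewrite /mxfun (invmx_unitary U) /rdiag.
  set v := \row_i _; set u := map_mx _ (spectral_diag A); suff -> : u = v by [].
  by apply/rowP => i; rewrite !mxE.
Qed.

Lemma herm_spectral n (A : 'M[R[i]]_n) : A^t* = A ->
  exists (Q : 'M[R[i]]_n) (r : 'I_n -> R),
    Q *m Q^t* = 1%:M /\ A = Q^t* *m rdiag r *m Q.
Proof. by case/mxfun_spectral => Q [r [QQ eA _]]; exists Q, r. Qed.

Lemma adj_congr m n (M : 'M[R[i]]_(m, n)) (A : 'M[R[i]]_n) :
  A^t* = A -> (M *m A *m M^t*)^t* = M *m A *m M^t*.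
Proof. by move=> hA; rewrite !adjM trmxCK hA mulmxA. Qed.

(** * Positive semidefinite and positive definite matrices *)

Lemma psd_adj n (A : 'M[R[i]]_n) : psdmx A -> A^t* = A.
Proof. by case=> /hermP. Qed.

Lemma pd_adj n (A : 'M[R[i]]_n) : pdmx A -> A^t* = A.
Proof. by case=> /hermP. Qed.

Lemma pd_psd n (A : 'M[R[i]]_n) : pdmx A -> psdmx A.
Proof.
case=> hA pA; split=> // v; have [->|v0] := eqVneq v 0.
  by rewrite !mul0mx mxE.
by rewrite ltW // pA.
Qed.

Lemma psdD n (A B : 'M[R[i]]_n) : psdmx A -> psdmx B -> psdmx (A + B).
Proof.
move=> pA pB; split; first by apply/hermP; rewrite adjD (psd_adj pA) (psd_adj pB).
move=> v; rewrite mulmxDr mulmxDl mxE.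
by apply: addr_ge0; [case: pA => _; apply | case: pB => _; apply].
Qed.

Lemma pdDr n (A B : 'M[R[i]]_n) : pdmx A -> psdmx B -> pdmx (A + B).
Proof.
move=> pA pB; split; first by apply/hermP; rewrite adjD (pd_adj pA) (psd_adj pB).
move=> v v0; rewrite mulmxDr mulmxDl mxE.
by apply: ltr_wpDr; [case: pB => _; apply | case: pA => _; apply].
Qed.

Lemma psdZ n (a : R) (A : 'M[R[i]]_n) : 0 <= a -> psdmx A -> psdmx (a%:C *: A).
Proof.
move=> a0 pA; split; first by apply/hermP; rewrite adjZ psd_adj.
move=> v; rewrite -scalemxAr -scalemxAl mxE mulr_ge0 ?ler0c//.
by case: pA => _; apply.
Qed.

Lemma pdZ n (a : R) (A : 'M[R[i]]_n) : 0 < a -> pdmx A -> pdmx (a%:C *: A).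
Proof.
move=> a0 pA; split; first by apply/hermP; rewrite adjZ pd_adj.
move=> v v0; rewrite -scalemxAr -scalemxAl mxE mulr_gt0 ?ltcR//.
by case: pA => _; apply.
Qed.

Lemma psd_congr m n (M : 'M[R[i]]_(m, n)) (A : 'M[R[i]]_n) :
  psdmx A -> psdmx (M *m A *m M^t*).
Proof.
move=> pA; split; first by apply/hermP; rewrite adj_congr // psd_adj.
move=> v; have [_ /(_ (v *m M))] := pA.
by rewrite adjM !mulmxA.
Qed.

Lemma pd_congr n (M A : 'M[R[i]]_n) :
  M \in unitmx -> pdmx A -> pdmx (M *m A *m M^t*).
Proof.
move=> uM pA; split; first by apply/hermP; rewrite adj_congr // pd_adj.
move=> v v0; have [_ /(_ (v *m M))] := pA.
rewrite adjM !mulmxA; apply; apply: contra_neq v0 => vM.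
by rewrite -(mulmxK uM v) vM mul0mx.
Qed.

Lemma form_rdiag n (r : 'I_n -> R) (v : 'rV[R[i]]_n) :
  (v *m rdiag r *m v^t*) 0 0 = \sum_i (r i)%:C * `|v 0 i| ^+ 2.
Proof.
rewrite mxE; apply: eq_bigr => i _.
rewrite mul_mx_diag !mxE normCK.
by rewrite mulrCA mulrA.
Qed.

Lemma psd_rdiag n (r : 'I_n -> R) : (forall i, 0 <= r i) -> psdmx (rdiag r).
Proof.
move=> r0; split; first by apply/hermP; exact: rdiag_adj.
move=> v; rewrite form_rdiag sumr_ge0 // => i _.
by rewrite mulr_ge0 ?exprn_ge0 // ler0c.
Qed.

Lemma pd_rdiag n (r : 'I_n -> R) : (forall i, 0 < r i) -> pdmx (rdiag r).
Proof.
move=> r0; split; first by apply/hermP; exact: rdiag_adj.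
move=> v /rV0Pn [j vj]; rewrite form_rdiag (bigD1 j) //=.
rewrite ltr_wpDr ?mulr_gt0 ?exprn_gt0 ?normr_gt0 ?ltcR//.
rewrite sumr_ge0 // => i _.
by rewrite mulr_ge0 ?exprn_ge0 // ler0c ltW.
Qed.

Lemma pd1 n : pdmx (1%:M : 'M[R[i]]_n).
Proof. by rewrite -[1]/(1%:C) -rdiag_const; apply: pd_rdiag. Qed.

Lemma psd_gram m n (M : 'M[R[i]]_(m, n)) : psdmx (M *m M^t*).
Proof. by rewrite -[X in X *m _]mulmx1; apply/psd_congr/pd_psd/pd1. Qed.

Lemma psd_diag n (A : 'M[R[i]]_n) k : psdmx A -> 0 <= complex.Re (A k k).
Proof.
case=> _ /(_ (delta_mx 0 k)) /=.
have := formee (@Num.conj R[i]) A k k; rewrite /form => ->.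
by rewrite lecE => /andP[].
Qed.

Lemma pd_diag n (A : 'M[R[i]]_n) k : pdmx A -> 0 < complex.Re (A k k).
Proof.
case=> _ /(_ (delta_mx 0 k)) /=.
have := formee (@Num.conj R[i]) A k k; rewrite /form => ->.
rewrite ltcE => /(_ _)/andP[]//; apply/rV0Pn; exists k.
by rewrite mxE !eqxx oner_neq0.
Qed.

Lemma psd_spectral n (A : 'M[R[i]]_n) : psdmx A ->
  exists (Q : 'M[R[i]]_n) (r : 'I_n -> R),
    [/\ Q *m Q^t* = 1%:M, A = Q^t* *m rdiag r *m Q & forall k, 0 <= r k].
Proof.
move=> pA; have [Q [r [QQ eA]]] := herm_spectral (psd_adj pA).
exists Q, r; split=> // k.
have := psd_diag k (psd_congr Q pA); rewrite eA !mulmxA QQ mul1mx.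
by rewrite -mulmxA QQ mulmx1 rdiagE eqxx.
Qed.

Lemma pd_spectral n (A : 'M[R[i]]_n) : pdmx A ->
  exists (Q : 'M[R[i]]_n) (r : 'I_n -> R),
    [/\ Q *m Q^t* = 1%:M, A = Q^t* *m rdiag r *m Q & forall k, 0 < r k].
Proof.
move=> pA; have [Q [r [QQ eA]]] := herm_spectral (pd_adj pA).
have uQ : Q \in unitmx by case/mulmx1_unit: QQ.
exists Q, r; split=> // k.
have := pd_diag k (pd_congr uQ pA); rewrite eA !mulmxA QQ mul1mx.
by rewrite -mulmxA QQ mulmx1 rdiagE eqxx.
Qed.

(** * Simultaneous diagonalization by congruence *)

Lemma congr_comp m n p (A : 'M[R[i]]_(m, n)) (B : 'M[R[i]]_(n, p)) C :
  A *m (B *m C *m B^t*) *m A^t* = (A *m B) *m C *m (A *m B)^t*.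
Proof. by rewrite adjM !mulmxA. Qed.

Lemma congrK n (S Y : 'M[R[i]]_n) : S \in unitmx ->
  invmx S *m (S *m Y *m S^t*) *m (invmx S)^t* = Y.
Proof. by move=> uS; rewrite congr_comp mulVmx// mul1mx adj1 mulmx1. Qed.

Lemma congrVK n (S Y : 'M[R[i]]_n) : S \in unitmx ->
  S *m (invmx S *m Y *m (invmx S)^t*) *m S^t* = Y.
Proof. by move=> uS; rewrite congr_comp mulmxV// mul1mx adj1 mulmx1. Qed.

(** Write X = S S^*, let the unitary [W] diagonalize the congruence of [Y] by S^-1, and take [L] to
    be S W^*. The [r k] are then the eigenvalues of X^-1 Y. *)
Lemma simdiag n (X Y : 'M[R[i]]_n) : pdmx X -> Y^t* = Y ->
  exists (L : 'M[R[i]]_n) (r : 'I_n -> R),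
    [/\ L \in unitmx, X = L *m L^t* & Y = L *m rdiag r *m L^t*].
Proof.
move=> pX hY; have [Q [s [QQ eX s0]]] := pd_spectral pX.
have uQ : Q \in unitmx by case/mulmx1_unit: QQ.
pose D := rdiag (fun k => Num.sqrt (s k)).
have DD : D *m D = rdiag s.
  by rewrite rdiagM; apply: eq_rdiag => k; rewrite -expr2 sqr_sqrtr ?ltW.
have uD : D \in unitmx by apply: rdiag_unit => k; rewrite gt_eqF ?sqrtr_gt0.
have hD : D^t* = D := rdiag_adj _.
clearbody D; pose S := Q^t* *m D.
have SS : S *m S^t* = X.
  by rewrite /S adjM hD trmxCK mulmxA -(mulmxA _ D D) DD -eX.
have uS : S \in unitmx by rewrite unitmx_mul adj_unit uQ.
clearbody S; have hC := adj_congr (invmx S) hY.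
have [W [r [WW eC]]] := herm_spectral hC.
have WW' := mulmx1C WW.
have uW : W \in unitmx by case/mulmx1_unit: WW.
exists (S *m W^t*), r; split.
- by rewrite unitmx_mul uS adj_unit.
- by rewrite adjM trmxCK mulmxA -(mulmxA S) WW' mulmx1 SS.
- by rewrite -congr_comp trmxCK -eC congrVK.
Qed.

Lemma simdiag_pd n (X Y : 'M[R[i]]_n) : pdmx X -> pdmx Y ->
  exists (L : 'M[R[i]]_n) (r : 'I_n -> R),
    [/\ L \in unitmx, forall k, 0 < r k, X = L *m L^t* &
       Y = L *m rdiag r *m L^t*].
Proof.
move=> pX pY; have [L [r [uL eX eY]]] := simdiag pX (pd_adj pY).
exists L, r; split=> // k.
have uL' : invmx L \in unitmx by rewrite unitmx_inv.
by have := pd_diag k (pd_congr uL' pY); rewrite eY congrK// rdiagE eqxx.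
Qed.

Lemma simdiag_psd n (X Y : 'M[R[i]]_n) : pdmx X -> psdmx Y ->
  exists (L : 'M[R[i]]_n) (r : 'I_n -> R),
    [/\ L \in unitmx, forall k, 0 <= r k, X = L *m L^t* &
       Y = L *m rdiag r *m L^t*].
Proof.
move=> pX pY; have [L [r [uL eX eY]]] := simdiag pX (psd_adj pY).
exists L, r; split=> // k.
by have := psd_diag k (psd_congr (invmx L) pY); rewrite eY congrK// rdiagE eqxx.
Qed.

End Hermitian.

(** * Trace inner product and log-determinant *)

Lemma mxtrace_congr (S : comNzRingType) n (L M A : 'M[S]_n) :
  \tr (L *m M *m A *m (L *m M) *m A) = \tr ((M *m A *m L) *m (M *m A *m L)).
Proof.
have -> : L *m M *m A *m (L *m M) *m A = L *m (M *m A *m L *m (M *m A)).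
  by rewrite !mulmxA.
by rewrite mxtrace_mulC !mulmxA.
Qed.

Section Inner.
Variables (R : realType) (n : nat).
Implicit Types (X Y Z A : 'M[R[i]]_n).

Lemma ReD (x y : R[i]) : complex.Re (x + y) = complex.Re x + complex.Re y.
Proof. by case: x; case: y. Qed.

Lemma ReN (x : R[i]) : complex.Re (- x) = - complex.Re x.
Proof. by case: x. Qed.

Lemma ReZ (a : R) (x : R[i]) : complex.Re (a%:C * x) = a * complex.Re x.
Proof. by case: x => x y /=; rewrite mul0r subr0. Qed.

Lemma Re_sum I (r : seq I) P (F : I -> R[i]) :
  complex.Re (\sum_(i <- r | P i) F i) = \sum_(i <- r | P i) complex.Re (F i).
Proof. exact: (big_morph (@complex.Re R) ReD). Qed.

Lemma innerC X Y : inner X Y = inner Y X.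
Proof. by rewrite /inner mxtrace_mulC. Qed.

Lemma innerDl X Y A : inner (X + Y) A = inner X A + inner Y A.
Proof. by rewrite /inner mulmxDl linearD /= ReD. Qed.

Lemma innerDr X Y A : inner A (X + Y) = inner A X + inner A Y.
Proof. by rewrite innerC innerDl !(innerC A). Qed.

Lemma innerNl X A : inner (- X) A = - inner X A.
Proof. by rewrite /inner mulNmx linearN /= ReN. Qed.

Lemma innerNr X A : inner A (- X) = - inner A X.
Proof. by rewrite innerC innerNl innerC. Qed.

Lemma innerBl X Y A : inner (X - Y) A = inner X A - inner Y A.
Proof. by rewrite innerDl innerNl. Qed.

Lemma innerBr X Y A : inner A (X - Y) = inner A X - inner A Y.
Proof. by rewrite innerDr innerNr. Qed.

Lemma innerZl (a : R) X A : inner (a%:C *: X) A = a * inner X A.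
Proof. by rewrite /inner -scalemxAl linearZ /= ReZ. Qed.

Lemma innerZr (a : R) X A : inner A (a%:C *: X) = a * inner A X.
Proof. by rewrite innerC innerZl innerC. Qed.

Lemma inner0r A : inner A 0 = 0.
Proof. by rewrite /inner mulmx0 mxtrace0. Qed.

Lemma inner_sumr I (r : seq I) P (F : I -> 'M[R[i]]_n) A :
  inner A (\sum_(i <- r | P i) F i) = \sum_(i <- r | P i) inner A (F i).
Proof.
by apply: (big_morph (inner A)) => [X Y|]; rewrite ?innerDr ?inner0r.
Qed.

Lemma inner_congr (L : 'M[R[i]]_n) (r : 'I_n -> R) A :
  inner (L *m rdiag r *m L^t*) A =
  \sum_i r i * complex.Re ((L^t* *m A *m L) i i).
Proof.
rewrite /inner -!mulmxA mxtrace_mulC -!mulmxA /mxtrace Re_sum.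
by apply: eq_bigr => k _; rewrite mul_diag_mx mxE [X in X * _]mxE ReZ mulmxA.
Qed.

Lemma inner_ge0 X A : psdmx X -> psdmx A -> 0 <= inner X A.
Proof.
move=> /psd_spectral [Q [r [_ -> r0]]] pA.
rewrite -{2}[Q]trmxCK inner_congr; apply: sumr_ge0 => k _; rewrite mulr_ge0 //.
by have := psd_diag k (psd_congr Q pA); rewrite trmxCK.
Qed.

Lemma inner1r X : inner X 1%:M = complex.Re (\tr X).
Proof. by rewrite /inner mulmx1. Qed.

(** Real-valued stand-in for the negative of [logdet_reg]; the two agree on positive definite
    matrices, to which the analysis is confined. *)
Definition ld X : R := ln (complex.Re (\det X)).

Lemma det_pd X : pdmx X -> 0 < complex.Re (\det X).
Proof.
move=> /pd_spectral [Q [r [QQ -> r0]]].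
rewrite !det_mulmx mulrAC -det_mulmx (mulmx1C QQ) det1 mul1r det_rdiag /=.
by apply: prodr_gt0.
Qed.

Lemma pd_unit X : pdmx X -> X \in unitmx.
Proof.
move=> /det_pd d0; rewrite unitmxE unitfE.
by apply: contraTneq d0 => -> /=; rewrite ltxx.
Qed.

Lemma ln_prod I (s : seq I) (F : I -> R) : (forall k, 0 < F k) ->
  ln (\prod_(k <- s) F k) = \sum_(k <- s) ln (F k).
Proof.
move=> F0; elim: s => [|k s IH]; first by rewrite !big_nil ln1.
by rewrite !big_cons lnM ?posrE ?prodr_gt0 // IH.
Qed.

Lemma ld_congr (L : 'M[R[i]]_n) (r : 'I_n -> R) :
  L \in unitmx -> (forall k, 0 < r k) ->
  ld (L *m rdiag r *m L^t*) = ld (L *m L^t*) + \sum_k ln (r k).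
Proof.
move=> uL r0; rewrite -ln_prod// -lnM ?posrE ?prodr_gt0//; last first.
  apply: det_pd; rewrite -[X in X *m _]mulmx1; apply: pd_congr => //.
  exact: pd1.
by rewrite /ld !det_mulmx mulrAC det_rdiag [X in complex.Re X]mulrC ReZ mulrC.
Qed.

Lemma adj_mulV (L : 'M[R[i]]_n) : L \in unitmx ->
  (invmx L)^t* *m L^t* = 1%:M.
Proof. by move=> uL; rewrite -adjM mulmxV // adj1. Qed.

Lemma adj_mulKV (L : 'M[R[i]]_n) : L \in unitmx ->
  L^t* *m (invmx L)^t* = 1%:M.
Proof. by move=> uL; rewrite -adjM mulVmx // adj1. Qed.

Lemma congr_inv (L D : 'M[R[i]]_n) : L \in unitmx -> D \in unitmx ->
  invmx (L *m D *m L^t*) = (invmx L)^t* *m invmx D *m invmx L.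
Proof.
move=> uL uD.
have e : (invmx L)^t* *m invmx D *m invmx L *m (L *m D *m L^t*) = 1%:M.
  rewrite !mulmxA mulmxKV // -(mulmxA _ (invmx D)) mulVmx// mulmx1.
  exact: adj_mulV.
have [_ uM] := mulmx1_unit e.
by rewrite -[RHS](mulmxK uM) e mul1mx.
Qed.

Lemma congr_inv_congr (L D : 'M[R[i]]_n) : L \in unitmx -> D \in unitmx ->
  L^t* *m invmx (L *m D *m L^t*) *m L = invmx D.
Proof.
move=> uL uD; rewrite congr_inv // !mulmxA mulmxKV //.
by rewrite adj_mulKV// mul1mx.
Qed.

Lemma pd_inv X : pdmx X -> pdmx (invmx X).
Proof.
move=> pX; have uX := pd_unit pX.
have uX' : invmx X \in unitmx by rewrite unitmx_inv.
have := pd_congr uX' pX; rewrite mulVmx // mul1mx.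
by rewrite -(adj_inv uX) (pd_adj pX).
Qed.

Lemma psd_le_tr A : psdmx A -> loewner_le A ((complex.Re (\tr A))%:C%:M).
Proof.
move=> /psd_spectral [Q [r [QQ eA r0]]]; have QQ' := mulmx1C QQ.
have -> : complex.Re (\tr A) = \sum_k r k.
  rewrite eA mxtrace_mulC mulmxA QQ mul1mx /mxtrace Re_sum.
  by apply: eq_bigr => k _; rewrite rdiagE eqxx.
have -> : (\sum_k r k)%:C%:M = Q^t* *m rdiag (fun=> \sum_k r k) *m Q.
  by rewrite rdiag_const scalar_mxC -mulmxA QQ' mulmx1.
rewrite /loewner_le eA congr_rdiagB -{2}[Q]trmxCK.
apply/psd_congr/psd_rdiag => k.
by rewrite subr_ge0 (bigD1 k) //= lerDl sumr_ge0.
Qed.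

Lemma Re_normC (z : R[i]) : 0 <= complex.Re (z * z^*).
Proof.
by rewrite -normCK; have := exprn_ge0 2 (normr_ge0 z); rewrite lecE => /andP[].
Qed.

(* Young's inequality [2 x_i x_j <= x_i^2 + x_j^2], then
   [L^* X L <= (tr X) L^* L <= (tr X)^2] for [X = L L^*]. *)
Lemma congr_frob (L : 'M[R[i]]_n) (x : 'I_n -> R) :
  inner (L *m rdiag x *m L^t*) (L *m rdiag x *m L^t*) <=
  complex.Re (\tr (L *m L^t*)) ^+ 2 * \sum_k x k ^+ 2.
Proof.
set Z := L *m rdiag x *m L^t*; pose K := L^t* *m L.
have hK : K^t* = K by rewrite adjM trmxCK.
have KC i j : K j i = (K i j)^* by rewrite -[in LHS]hK !mxE.
pose a i j := complex.Re (K i j * (K i j)^*).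
have aC i j : a i j = a j i.
  by rewrite /a (KC i j) conjCK mulrC.
have -> : inner Z Z = \sum_k x k * \sum_j x j * a k j.
  rewrite /Z inner_congr; apply: eq_bigr => k _; congr (_ * _).
  have -> : L^t* *m (L *m rdiag x *m L^t*) *m L = K *m rdiag x *m K.
    by rewrite /K !mulmxA.
  rewrite mxE Re_sum; apply: eq_bigr => j _.
  rewrite mul_mx_diag mxE [X in K k j * X]mxE (KC k j).
  by rewrite -mulrA mulrCA ReZ.
have le1 : \sum_k x k * \sum_j x j * a k j <=
    \sum_k \sum_j x k ^+ 2 * a k j.
  rewrite -(ler_pM2l (ltr0n R 2)) [leRHS](_ : _ =
     \sum_k \sum_j (x k ^+ 2 + x j ^+ 2) * a k j).
    rewrite mulr_sumr; apply: ler_sum => k _.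
    rewrite mulrA mulr_sumr; apply: ler_sum => j _.
    rewrite mulrA ler_wpM2r ?Re_normC//.
    have := sqr_ge0 (x k - x j); nra.
  rewrite mulr2n mulrDl !mul1r {2}exchange_big -big_split; apply: eq_bigr => k _ /=.
  rewrite -big_split; apply: eq_bigr => j _ /=.
  by rewrite mulrDl (aC j k).
apply: le_trans le1 _; rewrite mulr_sumr; apply: ler_sum => k _.
rewrite -mulr_sumr mulrC ler_wpM2r ?sqr_ge0//.
have pK : psdmx K by have := psd_gram (L^t*); rewrite trmxCK.
have trK : complex.Re (\tr (L *m L^t*)) = \sum_k complex.Re (K k k).
  by rewrite mxtrace_mulC /mxtrace Re_sum.
set t := complex.Re _; have t0 : 0 <= t.
  by rewrite /t trK sumr_ge0 // => j _; apply: psd_diag.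
apply: (@le_trans _ _ (t * complex.Re (K k k))); last first.
  rewrite expr2 ler_wpM2l // /t trK (bigD1 k) //= lerDl sumr_ge0 // => j _.
  exact: psd_diag.
have -> : \sum_j a k j = complex.Re ((K *m K) k k).
  by rewrite mxE Re_sum; apply: eq_bigr => j _; rewrite (KC k j).
have pX := psd_gram L.
have := psd_diag k (psd_congr (L^t*) (psd_le_tr pX)).
rewrite trmxCK mulmxBr mulmxBl -/t mul_mx_scalar -scalemxAl.
rewrite mxE [X in _ + X]mxE [X in X + _]mxE ReD ReN ReZ subr_ge0.
by rewrite /K !mulmxA.
Qed.

(* The numbers [r k] are the eigenvalues of [X^-1 Y]; [w A] is the diagonal of
   [A] in a basis that turns [X] into [1] and [Y] into [diag r]. *)
Lemma pair_spectral X Y : pdmx X -> pdmx Y ->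
  exists (r : 'I_n -> R) (w : 'M[R[i]]_n -> 'I_n -> R),
  [/\ forall k, 0 < r k,
      [/\ ld Y = ld X + \sum_k ln (r k), inner (invmx X) Y = \sum_k r k &
          inner (invmx Y) X = \sum_k (r k)^-1],
      forall A, inner X A = \sum_k w A k /\ inner Y A = \sum_k r k * w A k,
      forall A, psdmx A -> forall k, 0 <= w A k &
      (forall A, A^t* = A -> \sum_k w A k ^+ 2 <= inner (X *m A *m X) A) /\
      inner (Y - X) (Y - X) <= complex.Re (\tr X) ^+ 2 * \sum_k (r k - 1) ^+ 2].
Proof.
move=> pX pY; have [L [r [uL r0 eX eY]]] := simdiag_pd pX pY.
have rN0 k : r k != 0 by rewrite gt_eqF.
have ur := rdiag_unit rN0.
have eX1 : X = L *m rdiag (fun=> 1) *m L^t* by rewrite rdiag_const mulmx1.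
have u1 : rdiag (fun=> 1) \in @unitmx R[i] n.
  by apply: rdiag_unit => k; rewrite oner_neq0.
pose w A k := complex.Re ((L^t* *m A *m L) k k).
exists r, w; split=> //.
- split; first by rewrite eX eY ld_congr.
  + rewrite innerC eY inner_congr eX1 congr_inv_congr//.
    by apply: eq_bigr => k _; rewrite invmx_rdiag// rdiagE eqxx /= invr1 mulr1.
  + rewrite innerC eX1 inner_congr eY congr_inv_congr//.
    by apply: eq_bigr => k _; rewrite invmx_rdiag// rdiagE eqxx /= mul1r.
- move=> A; rewrite eY inner_congr; split=> //.
  by rewrite eX1 inner_congr; apply: eq_bigr => k _; rewrite mul1r.
- by move=> A pA k; have := psd_diag k (psd_congr (L^t*) pA); rewrite trmxCK.
split.
- move=> A hA.
  pose E := L^t* *m A *m L.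
  have hE : E^t* = E by rewrite !adjM trmxCK hA mulmxA.
  have -> : inner (X *m A *m X) A = complex.Re (\tr (E *m E^t*)).
    rewrite hE /inner eX; congr complex.Re.
    exact: mxtrace_congr.
  have -> : \sum_k w A k ^+ 2 = \sum_k complex.Re (E k k) ^+ 2 by [].
  clearbody E.
  rewrite /mxtrace Re_sum; apply: ler_sum => k _.
  rewrite mxE Re_sum (bigD1 k) //= ler_wpDr //.
    by apply: sumr_ge0 => j _; rewrite mxE [X in _ * _ X]mxE; apply: Re_normC.
  rewrite mxE [X in _ * _ X]mxE; case: (E k k) => x y /=.
  by rewrite mulrN opprK lerDl -expr2 sqr_ge0.
- have -> : Y - X = L *m rdiag (fun k => r k - 1) *m L^t*.
    by rewrite -rdiagB mulmxBr mulmxBl -eX1 -eY.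
  by rewrite eX; apply: congr_frob.
Qed.

End Inner.

(** * Loewner order and divergences *)

Section Scalar.
Variable R : realType.
Implicit Types (x y : R).

Lemma ln_le_sub1 y : 0 < y -> ln y <= y - 1.
Proof. by move=> y0; rewrite -{1}[y](subrK 1) addrC le_ln1Dx //; lra. Qed.

(** Through the square root s of y: ln y = 2 ln s <= 2 (s - 1), hence y - 1 - ln y >= (s - 1)^2 = (y
    - 1)^2 / (s + 1)^2, and (s + 1)^2 <= 5 near 1. *)
Lemma ln_sub1_quad y : 0 < y -> `|y - 1| <= 1 / 50 ->
  1 / 5 * (y - 1) ^+ 2 <= y - 1 - ln y.
Proof.
move=> y0; rewrite ler_norml => /andP[h1 h2].
set s := Num.sqrt y; have s0 : 0 < s by rewrite sqrtr_gt0.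
have ys : y = s ^+ 2 by rewrite sqr_sqrtr // ltW.
have := ln_le_sub1 s0; rewrite {3}ys lnXn // => hs.
have s1 : s <= 102 / 100 by rewrite ys in h2; nra.
have : (s + 1) ^+ 2 <= 5 by nra.
have := sqr_ge0 (s - 1); rewrite {}ys mulr2n; nra.
Qed.

Lemma le_of_sqr x y : 0 <= y -> x ^+ 2 <= y ^+ 2 -> x <= y.
Proof. by move=> y0 h; rewrite leNgt; apply/negP => yx; nra. Qed.

(** Converts a bound on one summand of the symmetric divergence into a bound on the distance of that
    eigenvalue from 1. *)
Lemma sqr_div_near (S y : R) : 0 <= S -> 0 < y -> (y - 1) ^+ 2 / y <= S ^+ 2 ->
  `|y - 1| <= S * (1 + S).
Proof.
move=> S0 y0; rewrite ler_pdivrMr // => h; rewrite ler_norml.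
by apply/andP; split; nra.
Qed.

Lemma cauchy_schwarz (I : finType) (x w : I -> R) (a b : R) :
  0 <= a -> 0 <= b -> \sum_k x k ^+ 2 <= a ^+ 2 -> \sum_k w k ^+ 2 <= b ^+ 2 ->
  \sum_k x k * w k <= a * b.
Proof.
have deg (u v : I -> R) : \sum_k u k ^+ 2 <= 0 ^+ 2 -> \sum_k u k * v k = 0.
  rewrite expr0n /= => u0; apply: big1 => k _.
  have /eqP: \sum_k u k ^+ 2 = 0.
    by apply/eqP; rewrite eq_le u0 sumr_ge0 // => j _; rewrite sqr_ge0.
  rewrite psumr_eq0 => [/allP/(_ k)|j _]; last by rewrite sqr_ge0.
  by rewrite mem_index_enum /= sqrf_eq0 => /(_ isT)/eqP ->; rewrite mul0r.
rewrite le_eqVlt => /predU1P[<- _ hx _|a0]; first by rewrite deg // mul0r.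
rewrite le_eqVlt => /predU1P[<- _ hw|b0 hx hw].
  under eq_bigr do rewrite mulrC.
  by rewrite deg // mulr0.
rewrite -(ler_pM2l (mulr_gt0 (mulr_gt0 (ltr0n R 2) a0) b0)).
apply: (@le_trans _ _ (b ^+ 2 * \sum_k x k ^+ 2 + a ^+ 2 * \sum_k w k ^+ 2)).
  rewrite !mulr_sumr -big_split; apply: ler_sum => k _ /=.
  have := sqr_ge0 (b * x k - a * w k); nra.
apply: (@le_trans _ _ (b ^+ 2 * a ^+ 2 + a ^+ 2 * b ^+ 2)).
  by rewrite lerD // ler_wpM2l // sqr_ge0.
by rewrite le_eqVlt; apply/orP; left; apply/eqP; ring.
Qed.

End Scalar.

Lemma scalerBVK (F : fieldType) (V : lmodType F) (a : F) (x y : V) :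
  a != 0 -> a *: (x - a^-1 *: y) = a *: x - y.
Proof. by move=> a0; rewrite scalerBr scalerA divff // scale1r. Qed.

Lemma sumrB1 (S : pzRingType) n (r : 'I_n -> S) :
  \sum_k r k - n%:R = \sum_k (r k - 1).
Proof. by rewrite sumrB sumr_const card_ord. Qed.

Lemma trace_conj_sqr (S : comNzRingType) n (K L M V D : 'M[S]_n) :
  K *m L = 1%:M -> M *m V = 1%:M ->
  \tr (V *m K *m (L *m D *m M) *m (V *m K) *m (L *m D *m M)) = \tr (D *m D).
Proof.
move=> KL MV; have -> : V *m K *m (L *m D *m M) = V *m (D *m M).
  by rewrite -mulmxA (mulmxA K) (mulmxA K) KL mul1mx.
have -> : V *m (D *m M) *m (V *m K) *m (L *m D *m M) =
    V *m (D *m (M *m V) *m (K *m L) *m D *m M) by rewrite !mulmxA.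
by rewrite MV KL !mulmx1 mxtrace_mulC -(mulmxA (D *m D)) MV mulmx1.
Qed.

Section Order.
Variables (R : realType) (n : nat).
Implicit Types (X Y Z A P U : 'M[R[i]]_n).

Lemma inner_mono A X Y : psdmx A -> loewner_le X Y -> inner X A <= inner Y A.
Proof. by move=> pA h; rewrite -subr_ge0 -innerBl; apply: inner_ge0. Qed.

Lemma psd0 : psdmx (0 : 'M[R[i]]_n).
Proof.
have := psd_rdiag (r := fun _ : 'I_n => 0 : R) (fun=> lexx 0).
by rewrite rdiag_const -scalemx1 scale0r.
Qed.

Lemma loewner_refl X : loewner_le X X.
Proof. by rewrite /loewner_le subrr; apply: psd0. Qed.

Lemma loewner_trans X Y Z : loewner_le X Y -> loewner_le Y Z -> loewner_le X Z.
Proof.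
move=> h1 h2; have -> : loewner_le X Z = psdmx (Z - Y + (Y - X)).
  by rewrite addrA subrK.
exact: (psdD h2 h1).
Qed.

Lemma loewner_leV X Y : pdmx X -> pdmx Y -> loewner_le X Y ->
  loewner_le (invmx Y) (invmx X).
Proof.
move=> pX pY; have [L [r [uL r0 eX eY]]] := simdiag_pd pX pY.
have rN0 k : r k != 0 by rewrite gt_eqF.
have eX1 : X = L *m rdiag (fun=> 1) *m L^t* by rewrite rdiag_const mulmx1.
have n1 (k : 'I_n) : (fun=> 1 : R) k != 0 by rewrite oner_neq0.
rewrite /loewner_le eX1 eY congr_rdiagB => pD.
have r1 k : 1 <= r k.
  have := psd_diag k (psd_congr (invmx L) pD).
  by rewrite congrK // rdiagE eqxx /= subr_ge0.
have ur := rdiag_unit rN0; have u1 := rdiag_unit n1.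
rewrite (congr_inv uL ur) (congr_inv uL u1) (invmx_rdiag rN0) (invmx_rdiag n1)
  congr_rdiagB.
rewrite -{2}[invmx L]trmxCK; apply/psd_congr/psd_rdiag => k.
by rewrite /= invr1 subr_ge0 invf_le1.
Qed.

(** The eigenvalues of P U are nonnegative with sum <U, P>, so each is below [c]. In contrapositive
    form, a reset forces <U, P> to be large. *)
Lemma psd_inner_lt P U (c : R) : pdmx P -> psdmx U -> inner U P < c ->
  loewner_lt U (c%:C *: invmx P).
Proof.
move=> pP pU h; have pZ := pd_inv pP.
have [L [r [uL r0 eZ eU]]] := simdiag_psd pZ pU.
have n1 (k : 'I_n) : (fun=> 1 : R) k != 0 by rewrite oner_neq0.
have eZ1 : invmx P = L *m rdiag (fun=> 1) *m L^t* by rewrite rdiag_const mulmx1.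
have u1 := rdiag_unit n1.
rewrite eU inner_congr -[P]invmxK eZ1 (congr_inv_congr uL u1) in h.
have e1 k : complex.Re (invmx (rdiag (fun=> 1)) k k) = 1 :> R.
  by rewrite rdiag_const invmx1 mxE eqxx.
have rc k : r k < c.
  apply: le_lt_trans h; rewrite (bigD1 k) //= e1 mulr1 lerDl sumr_ge0 // => j _.
  by rewrite e1 mulr1.
rewrite /loewner_lt eU eZ1 scalemxAl scalemxAr.
have -> : c%:C *: rdiag (fun=> 1) = rdiag (fun=> c) :> 'M[R[i]]_n.
  by rewrite !rdiag_const scale_scalar_mx mulr1.
rewrite congr_rdiagB; apply: (pd_congr uL).
by apply: pd_rdiag => k; rewrite subr_gt0.
Qed.

Lemma invmxZ_real (c : R) A : c != 0 -> A \in unitmx ->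
  invmx (c%:C *: A) = c^-1%:C *: invmx A.
Proof.
move=> c0 uA; rewrite invmxZ ?fmorphV// unitmxZ//.
by rewrite unitfE (inj_eq (@complexI R)).
Qed.

Lemma loewner_lt_swap P U (c : R) : 0 < c -> pdmx P -> pdmx U ->
  loewner_lt U (c%:C *: invmx P) -> loewner_le P (c%:C *: invmx U).
Proof.
move=> c0 pP pU /pd_psd h.
have := loewner_leV pU (pdZ c0 (pd_inv pP)) h.
have cN0 : c != 0 by rewrite gt_eqF.
have uP : invmx P \in unitmx by rewrite unitmx_inv pd_unit.
rewrite (invmxZ_real cN0 uP) invmxK => /(psdZ (ltW c0)).
by rewrite fmorphV scalerBVK // (inj_eq (@complexI R)).
Qed.

(** Concavity of log det, from ln r <= r - 1 on every eigenvalue of X^-1 Y: the tangent at [X] lies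
    above. The log-determinant bounds below are instances with a well-chosen [X]. *)
Lemma ld_le X Y : pdmx X -> pdmx Y -> ld Y <= ld X + inner (invmx X) Y - n%:R.
Proof.
move=> pX pY; have [r [w [r0 [-> -> _] _ _ _]]] := pair_spectral pX pY.
rewrite -addrA lerD2l sumrB1.
by apply: ler_sum => k _; apply: ln_le_sub1.
Qed.

Lemma ld_scalar (a : R) : 0 < a -> ld (a%:C%:M : 'M[R[i]]_n) = n%:R * ln a.
Proof.
move=> a0; rewrite /ld det_scalar -rmorphXn /= lnXn // mulr_natl.
done.
Qed.

Lemma pd_scalar (a : R) : 0 < a -> pdmx (a%:C%:M : 'M[R[i]]_n).
Proof. by move=> a0; rewrite -rdiag_const; apply: pd_rdiag. Qed.

Lemma inner_scalarl (a : R) X : inner (a%:C%:M) X = a * inner X 1%:M.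
Proof. by rewrite -(scalemx1 n a%:C) innerZl innerC. Qed.

Lemma invmx_scalarR (a : R) : 0 < a ->
  invmx (a%:C%:M : 'M[R[i]]_n) = (a^-1)%:C%:M.
Proof. by move=> a0; rewrite invmx_scalar fmorphV. Qed.

Lemma ld_le_scalar (a : R) X : 0 < a -> pdmx X ->
  ld X <= n%:R * ln a + inner X 1%:M / a - n%:R.
Proof.
move=> a0 pX; have := ld_le (pd_scalar a0) pX.
by rewrite ld_scalar // invmx_scalarR // inner_scalarl [_^-1 * _]mulrC.
Qed.

(** Symmetrized Bregman divergence of - log det, that is, <Y - X, X^-1 - Y^-1>. *)
Definition symdiv X Y := inner (invmx X) Y + inner (invmx Y) X - 2 * n%:R.

Lemma symdiv_sum (r : 'I_n -> R) : (forall k, 0 < r k) ->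
  \sum_k r k + \sum_k (r k)^-1 - 2 * n%:R = \sum_k (r k - 1) ^+ 2 / r k.
Proof.
move=> r0; have -> : 2 * n%:R = \sum_(k < n) (2 : R).
  by rewrite sumr_const card_ord mulr_natr.
rewrite -big_split -sumrB; apply: eq_bigr => k _ /=.
by field; rewrite gt_eqF.
Qed.

Lemma symdiv_term (r : 'I_n -> R) (s : R) : (forall k, 0 < r k) ->
  \sum_k (r k - 1) ^+ 2 / r k <= s -> forall k, (r k - 1) ^+ 2 / r k <= s.
Proof.
move=> r0; move=> h k; apply: le_trans h; rewrite (bigD1 k) //= lerDl.
by apply: sumr_ge0 => j _; rewrite divr_ge0 ?sqr_ge0 // ltW.
Qed.

Lemma symdiv_ge0 X Y : pdmx X -> pdmx Y -> 0 <= symdiv X Y.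
Proof.
move=> pX pY; have [r [w [r0 [_ e1 e2] _ _ _]]] := pair_spectral pX pY.
rewrite /symdiv e1 e2 symdiv_sum //.
by apply: sumr_ge0 => j _; rewrite divr_ge0 ?sqr_ge0 // ltW.
Qed.

(** Every eigenvalue of X^-1 Y is within S (1 + S) of 1, and <Y, A> weights these eigenvalues by
    nonnegative numbers with sum <X, A>. *)
Lemma near_inner X Y A (S : R) : pdmx X -> pdmx Y -> psdmx A -> 0 <= S ->
  symdiv X Y <= S ^+ 2 ->
  `|inner Y A - inner X A| <= S * (1 + S) * inner X A.
Proof.
move=> pX pY pA S0.
have [r [w [r0 [_ e1 e2] /(_ A)[-> ->] /(_ A pA) w0 _]]] := pair_spectral pX pY.
rewrite /symdiv e1 e2 symdiv_sum // => /(symdiv_term r0) h.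
rewrite -sumrB mulr_sumr; apply: le_trans (ler_norm_sum _ _ _) _.
apply: ler_sum => k _; rewrite -{2}[w A k]mul1r -mulrBl normrM.
by rewrite (ger0_norm (w0 k)) ler_wpM2r // sqr_div_near.
Qed.

(** Each [r k] is at most 1 + S (1 + S) <= (1 + S)^2, so removing the denominators costs this
    factor. *)
Lemma symdiv_sqr_sum (r : 'I_n -> R) (S : R) : (forall k, 0 < r k) -> 0 <= S ->
  \sum_k (r k - 1) ^+ 2 / r k <= S ^+ 2 ->
  \sum_k (r k - 1) ^+ 2 <= (S * (1 + S)) ^+ 2.
Proof.
move=> r0 S0 h; have h1 := symdiv_term r0 h.
apply: (@le_trans _ _ (\sum_k ((r k - 1) ^+ 2 / r k) * (1 + S) ^+ 2)).
  apply: ler_sum => k _.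
  rewrite -{1}[_ ^+ 2](divfK (_ : r k != 0)) ?gt_eqF//.
  apply: ler_wpM2l; first by rewrite divr_ge0 ?sqr_ge0 // ltW.
  have := sqr_div_near S0 (r0 k) (h1 k); rewrite ler_norml => /andP[_]; nra.
by rewrite -mulr_suml exprMn ler_wpM2r // sqr_ge0.
Qed.

(** Cauchy-Schwarz between the displacements r - 1 and the diagonal of [A] in the common basis.
    Measuring [A] by its local Frobenius norm avoids the dimension factor that would come from
    bounding <X, A>. *)
Lemma near_frob X Y A (S e : R) : pdmx X -> pdmx Y -> A^t* = A ->
  0 <= S -> 0 <= e -> symdiv X Y <= S ^+ 2 ->
  inner (X *m A *m X) A <= e ^+ 2 ->
  inner Y A - inner X A <= S * (1 + S) * e.
Proof.
move=> pX pY hA S0 e0.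
have [r [w [r0 [_ e1 e2] /(_ A)[-> ->] _ [/(_ A hA) hw _]]]] :=
  pair_spectral pX pY.
rewrite /symdiv e1 e2 symdiv_sum // => /(symdiv_sqr_sum r0 S0) h he.
rewrite -sumrB (eq_bigr (fun k => (r k - 1) * w A k)); last first.
  by move=> k _; rewrite mulrBl mul1r.
apply: cauchy_schwarz => //; last exact: le_trans he.
by rewrite mulr_ge0 ?addr_ge0.
Qed.

Lemma inner_le_frob X A (f : R) : pdmx X -> A^t* = A -> 0 <= f ->
  inner (X *m A *m X) A <= f ^+ 2 -> inner X A <= Num.sqrt n%:R * f.
Proof.
move=> pX hA f0.
have [r [w [_ _ /(_ A)[-> _] _ [/(_ A hA) hw _]]]] := pair_spectral pX pX.
move=> hf; rewrite (eq_bigr (fun k => 1 * w A k)); last by move=> k _; rewrite mul1r.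
apply: cauchy_schwarz; [exact: sqrtr_ge0 | exact: f0 | | exact: le_trans hf].
by rewrite sqr_sqrtr ?ler0n // expr1n sumr_const card_ord.
Qed.

(** The spectral norm is at most the Frobenius norm, here in coordinates where [X] is the identity;
    so [A] is below f X^-1 in the Loewner order. *)
Lemma inner_le_frob_inv X A M (f : R) : pdmx X -> A^t* = A -> psdmx M -> 0 <= f ->
  inner (X *m A *m X) A <= f ^+ 2 -> inner A M <= f * inner (invmx X) M.
Proof.
move=> pX hA pM f0 hf; have pV := pd_inv pX.
have [L [r [uL eV eA]]] := simdiag pV hA.
have eV1 : invmx X = L *m rdiag (fun=> 1) *m L^t* by rewrite rdiag_const mulmx1.
have eX : X = (invmx L)^t* *m invmx L.
  rewrite -[X]invmxK eV1 congr_inv ?rdiag_const ?unitmx1 // invmx1 mulmx1.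
  done.
have fr : inner (X *m A *m X) A = \sum_k r k ^+ 2.
  rewrite /inner eX eA (trace_conj_sqr _ (mulVmx uL) (adj_mulKV uL)).
  rewrite rdiagM /mxtrace Re_sum.
  by apply: eq_bigr => k _; rewrite rdiagE eqxx /= expr2.
have rf k : r k <= f.
  apply: (le_of_sqr f0).
  apply: le_trans hf; rewrite fr (bigD1 k) //= lerDl sumr_ge0 // => j _.
  exact: sqr_ge0.
rewrite eV1 eA !inner_congr mulr_sumr; apply: ler_sum => k _.
rewrite mul1r; apply: ler_wpM2r => //.
by have := psd_diag k (psd_congr (L^t*) pM); rewrite trmxCK.
Qed.

(** The right-hand side is the Bregman divergence of - log det, the sum of r - 1 - ln r with each r
    within 1/50 of 1. Since tr X = 1, the sum of (r - 1)^2 dominates the squared Frobenius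
    distance. *)
Lemma bregman_frob X Y (S : R) : pdmx X -> pdmx Y -> complex.Re (\tr X) = 1 ->
  0 <= S -> S <= 1 / 100 -> symdiv X Y <= S ^+ 2 ->
  1 / 5 * inner (Y - X) (Y - X) <= inner (invmx X) Y - n%:R + ld X - ld Y.
Proof.
move=> pX pY tX S0 S1.
have [r [w [r0 [-> e1 e2] _ _ [_ ]]]] := pair_spectral pX pY.
rewrite /symdiv tX expr1n mul1r e1 e2 symdiv_sum // => hf /(symdiv_term r0) h.
apply: (@le_trans _ _ (1 / 5 * \sum_k (r k - 1) ^+ 2)).
  by rewrite ler_wpM2l // divr_ge0.
rewrite sumrB1 opprD addrA addrK -sumrB mulr_sumr.
apply: ler_sum => k _; apply: ln_sub1_quad => //.
by apply: le_trans (sqr_div_near S0 (r0 k) (h k)) _; nra.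
Qed.

(** <X, A> is at least the least eigenvalue of [X] times tr A, and the inverse of that eigenvalue is
    at most tr X^-1. *)
Lemma inner_invl_ge X A : pdmx X -> psdmx A ->
  inner A 1%:M <= inner (invmx X) 1%:M * inner X A.
Proof.
move=> pX pA; have [r [w [r0 [_ _ e2] /(_ A)[e3 e4] /(_ A pA) w0 _]]] :=
  pair_spectral (@pd1 R n) pX.
rewrite innerC e2 e3 e4 mulr_sumr; apply: ler_sum => k _.
rewrite mulrA -{1}[w A k]mul1r ler_wpM2r // -(mulVf (_ : r k != 0)) ?gt_eqF//.
rewrite ler_pM2r // (bigD1 k) //= lerDl sumr_ge0 // => j _.
by rewrite invr_ge0 ltW.
Qed.

End Order.

(** * Bias matrices *)

Section UpdateAlgebra.
Variables (F : comUnitRingType) (n : nat).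
Implicit Types (S P M N X Y D : 'M[F]_n).

Lemma invmxM S P : S \in unitmx -> P \in unitmx ->
  invmx (S *m P) = invmx P *m invmx S.
Proof.
move=> uS uP; have uSP : S *m P \in unitmx by rewrite unitmx_mul uS.
have e : invmx P *m invmx S *m (S *m P) = 1%:M.
  by rewrite mulmxA mulmxKV // mulVmx.
by rewrite -[RHS](mulmxK uSP) e mul1mx.
Qed.

Lemma update_loewner_alg S P M N : S \in unitmx -> N = 1%:M - S *m P *m S ->
  P + invmx S *m M *m invmx S - invmx (S *m S) =
  invmx S *m (M - N) *m invmx S.
Proof.
move=> uS ->; rewrite invmxM // opprB mulmxDr mulmxDl mulmxBr mulmxBl mulmx1.
by rewrite !mulmxA mulVmx // mul1mx mulmxK // addrCA addrA.
Qed.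

Lemma update_compl_alg S P M N : S \in unitmx -> N = 1%:M - S *m P *m S ->
  M *m M = N *m M ->
  (P + invmx S *m M *m invmx S) *m (S *m S) *m (invmx S *m M *m invmx S) =
  invmx S *m M *m invmx S.
Proof.
move=> uS eN MM; set D := invmx S *m M *m invmx S.
have e1 : S *m S *m D = S *m M *m invmx S.
  by rewrite /D !mulmxA mulmxK.
rewrite -mulmxA e1 mulmxDl.
have -> : D *m (S *m M *m invmx S) = invmx S *m (M *m M) *m invmx S.
  by rewrite /D !mulmxA mulmxKV.
have -> : P *m (S *m M *m invmx S) =
    invmx S *m (S *m P *m S *m M) *m invmx S.
  by rewrite !mulmxA mulVmx // mul1mx.
have -> : S *m P *m S = 1%:M - N by rewrite eN opprB addrC subrK.
by rewrite -mulmxDl -mulmxDr MM mulmxBl mul1mx subrK.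
Qed.

Lemma trace_update P D X : (P + D) *m X *m D = D ->
  \tr (X *m D *m X *m D) = \tr (X *m D) - \tr (X *m P *m X *m D).
Proof.
move=> e; have -> : \tr (X *m D) = \tr (X *m ((P + D) *m X *m D)) by rewrite e.
rewrite !mulmxA mulmxDr mulmxDl mulmxDl linearD /=.
by rewrite addrAC subrr add0r.
Qed.

Lemma sandwich_alg X Y : X \in unitmx ->
  (Y *m invmx X - 1%:M) *m X *m (invmx X *m Y - 1%:M) =
  Y *m invmx X *m Y - Y - Y + X.
Proof.
move=> uX; rewrite mulmxBl mulmxKV // mul1mx mulmxBr mulmx1 mulmxBl.
by rewrite !mulmxA mulmxV // mul1mx opprB addrA addrAC.
Qed.

End UpdateAlgebra.

Section Update.
Variables (R : realType) (n : nat).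
Implicit Types (X Y P D : 'M[R[i]]_n).

Lemma unitary_congrM (Q : 'M[R[i]]_n) (r s : 'I_n -> R) : Q *m Q^t* = 1%:M ->
  (Q^t* *m rdiag r *m Q) *m (Q^t* *m rdiag s *m Q) =
  Q^t* *m rdiag (fun k => r k * s k) *m Q.
Proof.
move=> QQ; rewrite -rdiagM; move: QQ; move: (Q^t*) (rdiag r) (rdiag s).
move=> M A B QM; rewrite -mulmxA (mulmxA Q) (mulmxA Q) QM mul1mx.
by rewrite -!mulmxA.
Qed.

Lemma psd_unitary (Q : 'M[R[i]]_n) (r : 'I_n -> R) : (forall k, 0 <= r k) ->
  psdmx (Q^t* *m rdiag r *m Q).
Proof. by move=> r0; have := psd_congr (Q^t*) (psd_rdiag r0); rewrite trmxCK. Qed.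

Lemma sqrtmx_spec X : pdmx X ->
  [/\ (sqrtmx X)^t* = sqrtmx X, sqrtmx X *m sqrtmx X = X & sqrtmx X \in unitmx].
Proof.
move=> pX; have [Q [r [QQ eX ef]]] := mxfun_spectral (pd_adj pX).
have uQ : Q \in unitmx by case/mulmx1_unit: QQ.
have r0 k : 0 < r k.
  have := pd_diag k (pd_congr uQ pX); rewrite eX !mulmxA QQ mul1mx.
  by rewrite -mulmxA QQ mulmx1 rdiagE eqxx.
have SS : sqrtmx X *m sqrtmx X = X.
  rewrite /sqrtmx ef (unitary_congrM _ _ QQ) [RHS]eX.
  congr (_ *m _); congr (_ *m _); apply: eq_rdiag => k.
  by rewrite -expr2 sqr_sqrtr // ltW.
split=> //.
- rewrite /sqrtmx ef; apply: psd_adj; apply: psd_unitary => k.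
  by rewrite sqrtr_ge0.
- have := pd_unit pX; rewrite -{1}SS unitmx_mul.
  by case/andP.
Qed.

Lemma posmx_spec (N : 'M[R[i]]_n) : N^t* = N ->
  [/\ psdmx (posmx N), psdmx (posmx N - N) &
      posmx N *m posmx N = N *m posmx N].
Proof.
move=> hN; have [Q [r [QQ eN ef]]] := mxfun_spectral hN.
rewrite /posmx ef; split.
- by apply: psd_unitary => k; rewrite le_max lexx orbT.
- rewrite eN congr_rdiagB; apply: psd_unitary => k.
  by rewrite subr_ge0 le_max lexx.
- rewrite eN (unitary_congrM _ _ QQ) (unitary_congrM _ _ QQ).
  congr (_ *m _); congr (_ *m _).
  apply: eq_rdiag => k; case: (leP (r k) 0) => //.
  by rewrite !mulr0.
Qed.

(** These three facts are all that is used of the update. The last one is complementary slackness: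
    the product of the new matrix with [X] fixes the range of the increment, because N_+ N_+ = N N_+
    for a positive part. *)
Lemma update_P_spec P X : pdmx X -> P^t* = P ->
  let D := update_P P X - P in
  [/\ psdmx D, loewner_le (invmx X) (update_P P X) &
      update_P P X *m X *m D = D].
Proof.
move=> pX hP D; have [hS SS uS] := sqrtmx_spec pX.
rewrite /D /update_P; move: hS SS uS; move: (sqrtmx X) => S hS SS uS {D}.
have hN : (1%:M - S *m P *m S)^t* = 1%:M - S *m P *m S.
  by rewrite adjD adjN adj1 -{2}hS adj_congr // hS.
have [pM pMN MM] := posmx_spec hN.
move: pM pMN MM; move: (posmx _) => M pM pMN MM.
have hV : (invmx S)^t* = invmx S by rewrite -(adj_inv uS) hS.
have -> : P + invmx S *m M *m invmx S - P = invmx S *m M *m invmx S.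
  by rewrite addrC addKr.
split.
- by have := psd_congr (invmx S) pM; rewrite hV.
- rewrite /loewner_le -SS (update_loewner_alg M uS erefl).
  by have := psd_congr (invmx S) pMN; rewrite hV.
- rewrite -SS.
  exact: (update_compl_alg uS erefl MM).
Qed.

Lemma symdivC X Y : symdiv X Y = symdiv Y X.
Proof. by rewrite /symdiv [_ + inner _ X]addrC. Qed.

(* [0 <= (Y X^-1 - 1) X (X^-1 Y - 1) = Y X^-1 Y - 2 Y + X] *)
Lemma sandwich_ge X Y D : pdmx X -> Y^t* = Y -> psdmx D ->
  2 * inner Y D - inner X D <= inner (Y *m invmx X *m Y) D.
Proof.
move=> pX hY pD; have uX := pd_unit pX.
have hV : (invmx X)^t* = invmx X := pd_adj (pd_inv pX).
have := inner_ge0 (psd_congr (Y *m invmx X - 1%:M) (pd_psd pX)) pD.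
rewrite adjD adjN adj1 adjM hV hY (sandwich_alg Y uX).
rewrite innerDl !innerBl; lra.
Qed.

(** By complementary slackness the left-hand side equals <Y, D> - <Y P Y, D>, which by P >= X^-1 and
    [sandwich_ge] is at most <X, D> - <Y, D>. By [near_frob] this is at most S (1 + S) times the
    square root of the left-hand side, and one factor cancels. *)
Lemma update_frob X Y P D (S : R) : pdmx X -> pdmx Y -> psdmx D ->
  loewner_le (invmx X) P -> (P + D) *m Y *m D = D ->
  0 <= S -> symdiv X Y <= S ^+ 2 ->
  inner (Y *m D *m Y) D <= (S * (1 + S)) ^+ 2.
Proof.
move=> pX pY pD leP eD S0 hS.
have fr_eq : inner (Y *m D *m Y) D = inner Y D - inner (Y *m P *m Y) D.
  by rewrite /inner (trace_update eD) ReD ReN.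
have fr0 : 0 <= inner (Y *m D *m Y) D.
  by have := inner_ge0 (psd_congr Y pD) pD; rewrite (pd_adj pY).
have h1 : inner (Y *m invmx X *m Y) D <= inner (Y *m P *m Y) D.
  apply: (inner_mono pD); rewrite /loewner_le congr_mxB.
  by have := psd_congr Y leP; rewrite (pd_adj pY).
have h2 := sandwich_ge pX (pd_adj pY) pD.
have := @near_frob _ _ Y X D S (Num.sqrt (inner (Y *m D *m Y) D)) pY pX
  (psd_adj pD) S0 (sqrtr_ge0 _).
rewrite symdivC (sqr_sqrtr fr0) => /(_ hS (lexx _)).
move: fr_eq fr0 h1 h2; move: (inner (Y *m D *m Y) D) => fr.
move: (inner X D) (inner Y D) (inner _ D) (inner _ D) => p q u v.
move=> fr_eq fr0 h1 h2 h3.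
have h4 : Num.sqrt fr * Num.sqrt fr <= S * (1 + S) * Num.sqrt fr.
  by rewrite -expr2 (sqr_sqrtr fr0); lra.
rewrite -(sqr_sqrtr fr0) ler_pXn2r ?nnegrE ?sqrtr_ge0 ?mulr_ge0 ?addr_ge0 //.
have := sqrtr_ge0 fr; rewrite le_eqVlt => /predU1P[<-|f0].
  by rewrite ?mulr_ge0 ?addr_ge0.
by rewrite ler_pM2r in h4.
Qed.

End Update.

(** * Minimizers of log-det regularized objectives *)

Section ScalarLimit.
Variable R : realType.

Lemma ln_ge_quad (y : R) : - (1 / 2) <= y -> y - 2 * y ^+ 2 <= ln (1 + y).
Proof.
move=> hy; have y1 : 0 < 1 + y by lra.
have := ln_le_sub1 (y := (1 + y)^-1); rewrite invr_gt0 => /(_ y1).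
rewrite lnV ?posrE // => h.
have : (1 + y)^-1 <= 1 - y + 2 * y ^+ 2.
  rewrite -div1r ler_pdivrMr //; have := sqr_ge0 y; nra.
lra.
Qed.

(** Stands in for letting t tend to 0 in first-order optimality. *)
Lemma le_of_linear_error (u v c : R) :
  (forall t, 0 < t -> t <= 1 / 2 -> u <= v + t * c) -> u <= v.
Proof.
move=> h; rewrite leNgt; apply/negP => vu.
have c0 : 0 < `|c| + 1 by rewrite ltr_wpDl.
pose t := Num.min (1 / 2) ((u - v) / (2 * (`|c| + 1))).
have t0 : 0 < t by rewrite lt_min; apply/andP; split; [lra | rewrite divr_gt0 //; lra].
have t1 : t <= 1 / 2 by rewrite ge_min lexx.
have t2 : t * (2 * (`|c| + 1)) <= u - v.
  by rewrite -ler_pdivlMr ?mulr_gt0// ge_min lexx orbT.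
have := h t t0 t1; have := ler_norm c; nra.
Qed.

End ScalarLimit.

Section Argmin.
Variables (R : realType) (n : nat).
Implicit Types (X Y : 'M[R[i]]_n).

Lemma pd_of_det X : psdmx X -> complex.Re (\det X) != 0 -> pdmx X.
Proof.
move=> /psd_spectral [Q [r [QQ eX r0]]].
have uQ : Q \in unitmx by case/mulmx1_unit: QQ.
have uQ' : Q^t* \in unitmx by rewrite adj_unit.
rewrite eX !det_mulmx mulrAC -det_mulmx (mulmx1C QQ) det1 mul1r det_rdiag /=.
move/prodf_neq0 => rN.
have := pd_congr uQ' (A := rdiag r); rewrite trmxCK; apply.
by apply: pd_rdiag => k; rewrite lt_neqAle eq_sym rN // r0.
Qed.

Lemma logdet_reg_pd X : pdmx X -> logdet_reg X = (- ld X)%:E.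
Proof. by move=> pX; rewrite /logdet_reg lne_EFin ?det_pd. Qed.

Lemma density_uniform : (0 < n)%N -> density ((n%:R^-1 : R)%:C%:M : 'M[R[i]]_n).
Proof.
move=> n0; split; first by apply/pd_psd/pd_scalar; rewrite invr_gt0 ltr0n.
rewrite mxtrace_scalar -rmorphMn /= -mulr_natr.
by rewrite mulVf ?pnatr_eq0 -?lt0n.
Qed.

Lemma density_segment X Y (t : R) : 0 <= t -> t <= 1 -> density X -> density Y ->
  density (X + t%:C *: (Y - X)).
Proof.
move=> t0 t1 [pX tX] [pY tY]; split.
  have -> : X + t%:C *: (Y - X) = (1 - t)%:C *: X + t%:C *: Y.
    by rewrite rmorphB scalerBl scale1r scalerBr addrAC addrA.
  have t1' : 0 <= 1 - t by lra.
  exact: psdD (psdZ t1' pX) (psdZ t0 pY).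
by rewrite linearD linearZ linearB /= tX tY subrr mulr0 addr0.
Qed.

(** At a singular matrix the regularizer is infinite, while the uniform matrix has a finite
    objective. *)
Lemma argmin_pd (F : 'M[R[i]]_n -> R) (eta : R) X : (0 < n)%N -> 0 < eta ->
  is_argmin (fun X => (F X)%:E + (eta^-1)%:E * logdet_reg X)%E X -> pdmx X.
Proof.
move=> n0 eta0 [dX hX]; case: (dX) => pX _; apply: pd_of_det => //.
apply/negP => /eqP d0; have := hX _ (density_uniform n0).
have n0' : 0 < n%:R^-1 :> R by rewrite invr_gt0 ltr0n.
rewrite (logdet_reg_pd (pd_scalar n n0')) /logdet_reg d0 le0_lneNy //=.
by rewrite mulry gtr0_sg ?invr_gt0// mul1e addey.
Qed.

(* Along [X + t (Y - X)] the log-determinant is [sum ln (1 + t (r - 1))] with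
   [r] the spectrum of [X^-1 Y], so comparing the objective at small [t]
   replaces differentiation. *)
Lemma argmin_first_order (F : 'M[R[i]]_n -> R) (eta a b : R) X Y :
  (0 < n)%N -> 0 < eta ->
  is_argmin (fun X => (F X)%:E + (eta^-1)%:E * logdet_reg X)%E X ->
  pdmx Y -> density Y ->
  (forall t : R, F (X + t%:C *: (Y - X)) = F X + t * a + t ^+ 2 * b) ->
  inner (invmx X) Y - n%:R <= eta * a.
Proof.
move=> n0 eta0 hX pY dY hF; have pX := argmin_pd n0 eta0 hX.
case: hX => dX hX; have [L [r [uL r0 eX eY]]] := simdiag_pd pX pY.
have eX1 : X = L *m rdiag (fun=> 1) *m L^t* by rewrite rdiag_const mulmx1.
have -> : inner (invmx X) Y = \sum_k r k.
  have n1 (k : 'I_n) : (fun=> 1 : R) k != 0 by rewrite oner_neq0.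
  rewrite innerC eY inner_congr eX1 (congr_inv_congr uL (rdiag_unit n1)).
  by apply: eq_bigr => k _; rewrite rdiag_const invmx1 mxE eqxx mulr1.
rewrite sumrB1.
apply: (@le_of_linear_error _ _ _ (eta * b + 2 * \sum_k (r k - 1) ^+ 2)) => t t0 t1.
have rt k : 0 < 1 + t * (r k - 1) by have := r0 k; nra.
have eXt : X + t%:C *: (Y - X) = L *m rdiag (fun k => 1 + t * (r k - 1)) *m L^t*.
  have -> : rdiag (fun k => 1 + t * (r k - 1)) =
      rdiag (fun=> 1) + t%:C *: (rdiag r - rdiag (fun=> 1)) :> 'M[R[i]]_n.
    apply/matrixP => p q; rewrite !mxE; case: (p == q) => /=.
      by rewrite !mulr1n rmorphD rmorphM rmorphB.
    by rewrite !mulr0n subrr mulr0 addr0.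
  rewrite mulmxDr mulmxDl -eX1 -scalemxAr -scalemxAl mulmxBr mulmxBl -eX1 -eY.
  done.
have tle1 : t <= 1 by lra.
have pXt : pdmx (X + t%:C *: (Y - X)).
  by rewrite eXt; apply: (pd_congr uL); exact: pd_rdiag.
have := hX _ (density_segment (ltW t0) tle1 dX dY).
rewrite (logdet_reg_pd pX) (logdet_reg_pd pXt) hF -!EFinM -!EFinD lee_fin.
rewrite eXt (ld_congr uL rt) -eX => h.
have h2 : \sum_k (t * (r k - 1) - 2 * t ^+ 2 * (r k - 1) ^+ 2) <=
    \sum_k ln (1 + t * (r k - 1)).
  apply: ler_sum => k _; rewrite -mulrA -exprMn; apply: ln_ge_quad.
  by have := r0 k; nra.
rewrite sumrB -!mulr_sumr in h2.
have h3 : (eta^-1) * \sum_k ln (1 + t * (r k - 1)) <= t * a + t ^+ 2 * b by lra.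
have h4 : \sum_k ln (1 + t * (r k - 1)) <= eta * (t * a + t ^+ 2 * b).
  by rewrite mulrC ler_pdivrMr // mulrC in h3.
rewrite -(ler_pM2l t0); nra.
Qed.

End Argmin.

(** * Elliptic potential *)

Lemma square_alg (F : comUnitRingType) n (A : 'M[F]_n) (u w : 'rV[F]_n)
    (u' w' : 'cV[F]_n) : A \in unitmx ->
  (u + w *m invmx A) *m A *m (u' + invmx A *m w') =
  u *m A *m u' + u *m w' + (w *m u' + w *m invmx A *m w').
Proof.
move=> uA; rewrite mulmxDl mulmxKV // mulmxDr !mulmxDl !mulmxA mulmxK //.
by rewrite addrACA.
Qed.

Section Elliptic.
Variables (R : realType) (N : nat).
Variables (a b : R) (v : nat -> 'rV[R[i]]_N).
Hypotheses (a0 : 0 < a) (b0 : 0 < b).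

Definition gram m : 'M[R[i]]_N :=
  a%:C%:M + b%:C *: \sum_(1 <= r < m.+1) (v r)^t* *m v r.

Lemma psd_sum I (s : seq I) (F : I -> 'M[R[i]]_N) :
  (forall k, psdmx (F k)) -> psdmx (\sum_(k <- s) F k).
Proof.
move=> pF; elim: s => [|k s IH].
  by rewrite big_nil; apply: psd0.
by rewrite big_cons; apply: psdD.
Qed.

Lemma pd_gram m : pdmx (gram m).
Proof.
apply: pdDr; first exact: pd_scalar.
apply: psdZ; first exact: ltW.
by apply: psd_sum => r; have := psd_gram ((v r)^t*); rewrite trmxCK.
Qed.

Lemma gramS m : gram m.+1 = gram m + b%:C *: ((v m.+1)^t* *m v m.+1).
Proof. by rewrite /gram big_nat_recr //= scalerDr addrA. Qed.

Lemma inner_outer (V : 'M[R[i]]_N) (w : 'rV[R[i]]_N) :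
  inner V (w^t* *m w) = complex.Re ((w *m V *m w^t*) 0 0).
Proof.
rewrite /inner mulmxA mxtrace_mulC mulmxA /mxtrace.
by rewrite big_ord_recl big_ord0 addr0.
Qed.

Lemma inner_invl (V : 'M[R[i]]_N) : pdmx V -> inner (invmx V) V = N%:R.
Proof.
move=> pV; rewrite /inner (mulVmx (pd_unit pV)) mxtrace1.
by rewrite -(rmorph_nat (real_complex R)).
Qed.

(** Tangent of log det at the later Gram matrix, evaluated at the earlier one. *)
Lemma potential_step m :
  b * complex.Re ((v m.+1 *m invmx (gram m.+1) *m (v m.+1)^t*) 0 0) <=
  ld (gram m.+1) - ld (gram m).
Proof.
have := ld_le (pd_gram m.+1) (pd_gram m).
have -> : inner (invmx (gram m.+1)) (gram m) = N%:R -
    b * inner (invmx (gram m.+1)) ((v m.+1)^t* *m v m.+1).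
  rewrite -(inner_invl (pd_gram m.+1)) -innerZr -innerBr.
  by congr (inner _ _); rewrite gramS addrK.
rewrite inner_outer; move: (ld _) (ld _) (_ * complex.Re _) => p q r; lra.
Qed.

Lemma complete_square (A : 'M[R[i]]_N) (u w : 'rV[R[i]]_N) : pdmx A ->
  0 <= complex.Re ((u *m A *m u^t*) 0 0) + 2 * complex.Re ((u *m w^t*) 0 0) +
    complex.Re ((w *m invmx A *m w^t*) 0 0).
Proof.
move=> pA; have uA := pd_unit pA.
have hV : (invmx A)^t* = invmx A := pd_adj (pd_inv pA).
have [_ /(_ (u + w *m invmx A))] := pd_psd pA.
rewrite adjD adjM hV.
rewrite (square_alg _ _ _ _ uA).
have -> : w *m u^t* = (u *m w^t*)^t* by rewrite adjM trmxCK.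
rewrite mxE [X in _ + X]mxE [X in X + _]mxE lecE => /andP[_].
rewrite !ReD [complex.Re ((_)^t* _ _)](_ : _ = complex.Re ((u *m w^t*) 0 0)).
  by rewrite mulr_natl mulr2n !addrA.
by rewrite !mxE; case: (\sum_j _).
Qed.

Lemma gram_form m (u : 'rV[R[i]]_N) (c : nat -> R) :
  (forall r, (1 <= r <= m)%N -> (u *m (v r)^t*) 0 0 = (c r)%:C) ->
  complex.Re ((u *m gram m *m u^t*) 0 0) =
  a * complex.Re ((u *m u^t*) 0 0) + b * \sum_(1 <= r < m.+1) c r ^+ 2.
Proof.
move=> hc; rewrite /gram mulmxDr mulmxDl mul_mx_scalar -scalemxAl.
rewrite -scalemxAr -scalemxAl mxE [X in X + _]mxE [X in _ + X]mxE ReD !ReZ.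
congr (_ + _ * _); rewrite mulmx_sumr mulmx_suml summxE Re_sum.
rewrite big_nat_cond [RHS]big_nat_cond; apply: eq_bigr => r /andP[hr _].
rewrite mulmxA -(mulmxA (u *m _)).
have -> : v r *m u^t* = (u *m (v r)^t*)^t* by rewrite adjM trmxCK.
rewrite mxE big_ord_recl big_ord0 addr0 [X in _ * X]mxE [X in _ * _ X]mxE.
rewrite (hc r) //; have -> : Num.conj (c r)%:C = (c r)%:C := conjc_real _.
by rewrite -rmorphM /= expr2.
Qed.

(** With A the Gram matrix, completing the square in u bounds the left-hand side by half of v A^-1
    v^*, which [potential_step] charges to the growth of log det. *)
Lemma elliptic_step m (u : 'rV[R[i]]_N) (c : nat -> R) :
  (forall r, (1 <= r <= m.+1)%N -> (u *m (v r)^t*) 0 0 = (c r)%:C) ->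
  c m.+1 - 1 / 2 * (a * complex.Re ((u *m u^t*) 0 0) +
    b * \sum_(1 <= r < m.+2) c r ^+ 2) <=
  (2 * b)^-1 * (ld (gram m.+1) - ld (gram m)).
Proof.
move=> hc; rewrite -(gram_form hc).
have h1 := complete_square (- u) (v m.+1) (pd_gram m.+1).
have h2 := potential_step m.
rewrite [_^-1 * _]mulrC ler_pdivlMr ?mulr_gt0//.
have e : complex.Re ((- u *m (v m.+1)^t*) 0 0) = - c m.+1.
  by rewrite mulNmx mxE ReN (hc m.+1) //= leqnn.
move: h1; rewrite e !mulNmx adjN mulmxN opprK.
move: h2; move: (complex.Re _) (complex.Re _) (ld _) (ld _) => p q l l' h2 h1.
have := mulr_ge0 (ltW b0) h1; nra.
Qed.

Lemma ld_gram_le m (t : R) : 0 < t ->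
  ld (gram m) <= N%:R * ln t + (N%:R * a +
    b * \sum_(1 <= r < m.+1) complex.Re ((v r *m (v r)^t*) 0 0)) / t - N%:R.
Proof.
move=> t0; have := ld_le_scalar t0 (pd_gram m).
have -> // : inner (gram m) 1%:M = N%:R * a +
    b * \sum_(1 <= r < m.+1) complex.Re ((v r *m (v r)^t*) 0 0).
rewrite innerDl inner_scalarl innerZl inner1r mxtrace1.
rewrite -(rmorph_nat (real_complex R)) /= mulrC; congr (_ + b * _).
rewrite innerC inner_sumr; apply: eq_bigr => r _.
by rewrite inner_outer mulmx1.
Qed.

(** The growth of log det telescopes, and its final value is bounded by the tangent at [t] times the
    identity, with [t] left to the caller. The numbers [c] have two indices because the Gram form at
    step s pairs [u s] with every [v r], r <= s. *)
Lemma elliptic_potential m (u : nat -> 'rV[R[i]]_N) (c : nat -> nat -> R) (t : R) :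
  0 < t ->
  (forall s r, (1 <= r <= s)%N -> (s <= m)%N ->
     (u s *m (v r)^t*) 0 0 = (c s r)%:C) ->
  \sum_(1 <= s < m.+1) (c s s - 1 / 2 * (a * complex.Re ((u s *m (u s)^t*) 0 0) +
    b * \sum_(1 <= r < s.+1) c s r ^+ 2)) <=
  (2 * b)^-1 * (N%:R * (ln t - ln a) + (N%:R * a +
    b * \sum_(1 <= r < m.+1) complex.Re ((v r *m (v r)^t*) 0 0)) / t - N%:R).
Proof.
move=> t0 hc.
have b2 : 0 <= (2 * b)^-1 by rewrite invr_ge0 mulr_ge0 // ltW.
have key k : (k <= m)%N ->
  \sum_(1 <= s < k.+1) (c s s - 1 / 2 * (a * complex.Re ((u s *m (u s)^t*) 0 0) +
    b * \sum_(1 <= r < s.+1) c s r ^+ 2)) <=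
  (2 * b)^-1 * (ld (gram k) - ld (gram 0)).
  elim: k => [_|k IH km]; first by rewrite big_geq // subrr mulr0.
  rewrite big_nat_recr //=.
  have hk r : (1 <= r <= k.+1)%N -> (u k.+1 *m (v r)^t*) 0 0 = (c k.+1 r)%:C.
    by move=> hr; apply: hc.
  apply: le_trans (lerD (IH (ltnW km)) (elliptic_step hk)) _.
  by rewrite -mulrDr [_ + (_ - _)]addrC addrA subrK.
apply: le_trans (key m (leqnn m)) _.
rewrite ler_wpM2l //; have := ld_gram_le m t0.
have -> : ld (gram 0) = N%:R * ln a.
  by rewrite /gram big_geq // scaler0 addr0 ld_scalar.
by rewrite mulrBr; move: (ld _) (_ / t) => p q; lra.
Qed.

End Elliptic.

Lemma mxvec_form (R : realType) n (Y M : 'M[R[i]]_n) :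
  (mxvec Y *m (mxvec M)^t*) 0 0 = \tr (Y *m M^t*).
Proof.
rewrite mxE (reindex _ (curry_mxvec_bij n n)) /=.
transitivity (\sum_(p : 'I_n * 'I_n) Y p.1 p.2 * Num.conj (M p.1 p.2)).
  apply: eq_bigr => -[p q] _ /=.
  by rewrite mxvecE [X in _ * X = _]mxE [X in _ * _ X = _]mxE mxvecE.
rewrite -(pair_bigA _ (fun p q => Y p q * Num.conj (M p q))) /=.
by apply: eq_bigr => p _; rewrite mxE; apply: eq_bigr => q _; rewrite !mxE.
Qed.

(** Lets the elliptic potential act on matrices, vectorized to rows of length n^2; between Hermitian
    matrices the form is real. *)
Lemma mxvec_inner (R : realType) n (Y M : 'M[R[i]]_n) :
  Y^t* = Y -> M^t* = M -> (mxvec Y *m (mxvec M)^t*) 0 0 = (inner Y M)%:C.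
Proof.
move=> hY hM; rewrite mxvec_form hM /inner RRe_real//; apply/CrealP.
have e : \tr (Y *m M) = \tr ((Y *m M)^t*).
  by rewrite adjM hY hM mxtrace_mulC.
rewrite [RHS]e /mxtrace rmorph_sum; apply: eq_bigr => k _.
by rewrite [in RHS]mxE [in RHS]mxE.
Qed.

(** * Scalar estimates *)

Section Tangent.
Variable R : realType.
Implicit Types (z y beta : R).

Definition quad beta z : R := 1 - z + beta / 2 * (1 - z) ^+ 2.

Lemma quad_tangent beta y z :
  quad beta z = quad beta y - (1 + beta - beta * y) * (z - y) +
    beta / 2 * (z - y) ^+ 2.
Proof. by rewrite /quad; field. Qed.

(* [ln z = 4 ln v <= 4 (v - 1)] for [z = v^4] avoids calculus; fourth roots are
   precise enough up to [beta z <= 11/20], while the bound holds up to [1]. *)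
Lemma ln_le_quad beta z : 0 < beta -> beta <= 1 / 50 -> 0 < z ->
  beta * z <= 11 / 20 -> ln z <= - quad beta z.
Proof.
move=> b0 b1 z0 bz.
pose v := Num.sqrt (Num.sqrt z).
have v0 : 0 < v by rewrite !sqrtr_gt0.
have zv : z = v ^+ 4.
  by rewrite (exprM v 2 2) !sqr_sqrtr ?sqrtr_ge0 // ltW.
have := ln_le_sub1 v0; move: bz; rewrite zv lnXn // -mulr_natr => bz lnv.
apply: (@le_trans _ _ (4 * (v - 1))); first by lra.
rewrite /quad -subr_ge0.
have -> : - (1 - v ^+ 4 + beta / 2 * (1 - v ^+ 4) ^+ 2) - 4 * (v - 1) =
  (v - 1) ^+ 2 * (v ^+ 2 + 2 * v + 3 -
     beta / 2 * (v ^+ 3 + v ^+ 2 + v + 1) ^+ 2) by field.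
rewrite mulr_ge0 ?sqr_ge0 // subr_ge0.
case: (lerP v 1) => v1.
  have h : v ^+ 3 + v ^+ 2 + v + 1 <= 4.
    have h2 : v ^+ 2 <= 1 by rewrite expr_le1 // ltW.
    have h3 : v ^+ 3 <= 1 by rewrite expr_le1 // ltW.
    lra.
  have h0 : 0 <= v ^+ 3 + v ^+ 2 + v + 1.
    by rewrite !addr_ge0 ?exprn_ge0 // ltW.
  have h16 : (v ^+ 3 + v ^+ 2 + v + 1) ^+ 2 <= 16 by nra.
  have := sqr_ge0 v; have := sqr_ge0 (v ^+ 3 + v ^+ 2 + v + 1); nra.
(* For v > 1 the factor v^4 brings out beta v^4, which is at most 11/20; the lower powers are then
   compared with v^4. *)
rewrite -(ler_pM2r (exprn_gt0 4 v0)).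
apply: (@le_trans _ _ (11 / 40 * (v ^+ 3 + v ^+ 2 + v + 1) ^+ 2)).
  rewrite mulrAC ler_wpM2r ?sqr_ge0 //; lra.
have hv m : (m <= 4)%N -> v ^+ m <= v ^+ 4.
  by move=> hm; apply: ler_weXn2l => //; exact: ltW.
have := (hv 0%N isT, hv 1%N isT, hv 2%N isT, hv 3%N isT).
move=> [[[]]]; rewrite expr0 expr1 => h0 h1 h2 h3.
have h5 : v ^+ 4 <= v ^+ 5 by apply: ler_weXn2l => //; exact: ltW.
have h6 : v ^+ 4 <= v ^+ 6 by apply: ler_weXn2l => //; exact: ltW.
lra.
Qed.

(* The tangent of the surrogate at a point with [beta y <= 11/20] bounds the
   loss at every [z > 0], including where the surrogate itself does not. *)
Lemma ln_le_tangent beta y z : 0 < beta -> beta <= 1 / 50 -> 0 < z ->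
  0 <= y -> beta * y <= 11 / 20 ->
  ln z <= - quad beta y + (1 + beta - beta * y) * (z - y).
Proof.
move=> b0 b1 z0 y0 hy.
case: (lerP (beta * z) (11 / 20)) => hz.
  apply: le_trans (ln_le_quad b0 b1 z0 hz) _.
  rewrite (quad_tangent beta y z).
  have : 0 <= beta / 2 * (z - y) ^+ 2 by rewrite mulr_ge0 ?sqr_ge0 // divr_ge0 // ltW.
  lra.
(* Beyond the threshold [k], ln stays below its tangent at [k], whose slope 20/11 beta is smaller
   than the slope at [y] of the negated surrogate. *)
pose k := 11 / 20 / beta.
have k0 : 0 < k by rewrite divr_gt0 //; lra.
have bk : beta * k = 11 / 20 by rewrite /k mulrC divfK // gt_eqF.
have h1 : ln z <= ln k + (z / k - 1).
  rewrite -lerBlDl -ln_div ?posrE //; apply: ln_le_sub1; exact: divr_gt0.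
have h2 : ln k <= - quad beta k by apply: ln_le_quad => //; rewrite bk.
have h3 : z / k - 1 = (20 / 11 * beta) * (z - k).
  rewrite mulrBr -(mulrA (20 / 11) beta k) bk /k.
  by field; rewrite gt_eqF.
have h4 : k <= z by rewrite -(ler_pM2l b0) bk ltW.
have h5 : 20 / 11 * beta <= 1 + beta - beta * y by lra.
have h6 : 0 <= beta / 2 * (k - y) ^+ 2 by rewrite mulr_ge0 ?sqr_ge0 // divr_ge0 // ltW.
have := quad_tangent beta y k; nra.
Qed.

End Tangent.

(** Here [DL] stands for d ln T, [4 * B] for 1/eta, [lU] and [lW] for the log-determinants of the
    last surrogate minimizer and of the comparator. The coefficient 49/22 comes from the elliptic
    potential, 11/5 from the bias increments, 4 from the comparator. *)
Lemma regret_combine (R : realType)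
    (B D DL rg lU lW q pot0 potn iP gains incrs l0 l1 : R) :
  0 < B -> rg <= 4 * B * (lU - lW) - q ->
  4 * B * lU - q <= - potn - (B * iP - B * D) ->
  pot0 - potn <= gains + 11 / 10 * B * incrs ->
  gains <= 49 / 22 * (B * DL) -> incrs <= l1 - l0 -> l1 <= 2 * DL -> 0 <= l0 ->
  - DL <= lW -> 0 <= pot0 ->
  rg <= 49 / 22 * (B * DL) + 11 / 5 * (B * DL) + 4 * (B * DL) + B * D - B * iP.
Proof.
move=> B0 h1 h2 h3 h4 h5 h6 h7 h8 h9.
have h10 : B * incrs <= B * (2 * DL) by rewrite ler_pM2l //; lra.
have h11 : B * - DL <= B * lW by rewrite ler_pM2l.
lra.
Qed.

(** * Numerical parameters of the algorithm *)

Section Constants.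
Variables (R : realType) (d T : nat) (B eta beta : R).
Hypotheses (d1 : (1 <= d)%N) (hT : (110 * d ^ 2 <= T)%N).
Hypothesis hB : B = 264 / 5 * d%:R ^+ 2 * ln (T%:R : R).
Hypothesis heta : eta = 1 / (4 * B).
Hypothesis hbeta : beta = 11 * d%:R / (7 * B).

Local Notation L := (ln (T%:R : R)).
Local Notation D := (d%:R : R).

Lemma dim_ge1 : 1 <= D. Proof. by rewrite ler1n. Qed.

Lemma horizon_ge_dim : 110 * D ^+ 2 <= T%:R.
Proof. by rewrite -natrX -natrM ler_nat. Qed.

Lemma horizon_ge110 : 110 <= T%:R :> R.
Proof.
have h : 1 <= D ^+ 2 by rewrite exprn_ege1 // dim_ge1.
by have := horizon_ge_dim; lra.
Qed.

Lemma horizon_gt0 : 0 < T%:R :> R.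
Proof. by apply: lt_le_trans horizon_ge110; rewrite ltr0n. Qed.

Lemma ln2_ge_half : 1 / 2 <= ln 2 :> R.
Proof.
have := @ln_le_sub1 R (2^-1); rewrite invr_gt0 ltr0n => /(_ isT).
rewrite lnV ?posrE //; lra.
Qed.

Lemma ln_horizon_ge3 : 3 <= L.
Proof.
have h : ln (2 ^+ 6 : R) <= L.
  rewrite ler_ln ?posrE ?exprn_gt0 ?horizon_gt0 //.
  apply: le_trans horizon_ge110; rewrite !exprS expr0; lra.
rewrite lnXn // -[ln 2 *+ 6]mulr_natl in h; have := ln2_ge_half; lra.
Qed.

Lemma ln_horizon_le : L <= T%:R / 2.
Proof.
have h := @ln_le_sub1 R (T%:R / 2); rewrite divr_gt0 ?horizon_gt0 // in h.
have {h} := h isT; rewrite ln_div ?posrE ?horizon_gt0 //.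
have := @ln_le_sub1 R 2 (ltr0n _ 2); lra.
Qed.

Lemma bias_ge : 158 <= B.
Proof.
rewrite hB; have h1 := dim_ge1; have h2 := ln_horizon_ge3.
have h3 : 1 <= D ^+ 2 by rewrite exprn_ege1.
have : 3 <= D ^+ 2 * L by nra.
lra.
Qed.

Lemma bias_gt0 : 0 < B. Proof. have := bias_ge; lra. Qed.

Lemma etaB : eta * B = 1 / 4.
Proof. by rewrite heta; field; rewrite gt_eqF ?bias_gt0. Qed.

Lemma eta_inv : eta^-1 = 4 * B.
Proof. by rewrite heta invf_div divr1. Qed.

Lemma eta_gt0 : 0 < eta.
Proof. by rewrite heta divr_gt0 // mulr_gt0 ?bias_gt0. Qed.

Lemma eta_le : eta <= 1 / 600.
Proof. by rewrite -(ler_pM2r bias_gt0) etaB; have := bias_ge; lra. Qed.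

Lemma beta_gt0 : 0 < beta.
Proof.
have := dim_ge1 => h.
by rewrite hbeta divr_gt0 ?mulr_gt0 ?bias_gt0//; lra.
Qed.

Lemma betaB : 7 * (beta * B) = 11 * D.
Proof. by rewrite hbeta; field; rewrite gt_eqF ?bias_gt0. Qed.

Lemma beta_dim_ln : 168 * (beta * (D * L)) = 5.
Proof.
have D0 : D != 0 by have := dim_ge1; case: eqP => // ->; lra.
apply: (mulIf D0); have := betaB; rewrite hB => h.
have -> : 5 * D = 5 / 11 * (7 * (beta * (264 / 5 * D ^+ 2 * L))).
  by rewrite h; field.
by field.
Qed.

Lemma beta_le : beta <= 1 / 50.
Proof.
have h1 := dim_ge1; have h2 := ln_horizon_ge3; have h3 := beta_gt0.
have h : 3 <= D * L by nra.
have := beta_dim_ln; have : beta * 3 <= beta * (D * L) by rewrite ler_pM2l.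
lra.
Qed.

Lemma eta_dim_beta : 44 * (D * eta) = 7 * beta.
Proof.
have B0 : B != 0 by rewrite gt_eqF ?bias_gt0.
apply: (mulIf B0); have := betaB; have := etaB.
have -> : 44 * (D * eta) * B = 44 * D * (eta * B) by ring.
by move=> ->; lra.
Qed.

(** The form in which the ratio eta d / beta = 7/44 enters the stability of the surrogate minimizers
    and the bound on their inverses. *)
Lemma eta_quad : 20 * (eta * D * (1 + beta) ^+ 2) <= 4 * beta.
Proof.
have h := eta_dim_beta; have b1 := beta_le; have b0 := beta_gt0.
have -> : eta * D = 7 / 44 * beta by rewrite mulrC; lra.
have : (1 + beta) ^+ 2 <= 11 / 10 by nra.
nra.
Qed.

(* The constant of the reset condition. *)
Definition radius : R := (2 * (1 + 6 * eta) * beta)^-1.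

Lemma radius_gt0 : 0 < radius.
Proof.
have h1 := eta_gt0; have h2 := beta_gt0.
by rewrite invr_gt0 !mulr_gt0 //; lra.
Qed.

Lemma radiusE : radius * (1 + 6 * eta) = 84 / 5 * (D * L).
Proof.
have h1 := eta_gt0; have h2 := beta_gt0; have h := beta_dim_ln.
have -> : D * L = 5 / 168 / beta.
  apply: (mulfI (lt0r_neq0 h2)).
  have -> : beta * (5 / 168 / beta) = 5 / 168 by field; rewrite gt_eqF.
  by move: h; move: (beta * _) => p; lra.
rewrite /radius; field; rewrite ?gt_eqF //; lra.
Qed.

Lemma beta_radius : beta * radius <= 1 / 2.
Proof.
have h1 := eta_gt0; have h2 := beta_gt0; have r0 := radius_gt0.
have e : beta * radius * (1 + 6 * eta) = 1 / 2.
  by rewrite -mulrA radiusE; have := beta_dim_ln; lra.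
have : 0 <= beta * radius * eta by rewrite !mulr_ge0 // ltW.
lra.
Qed.

Lemma radius_le : radius <= 84 / 5 * (D * L).
Proof.
rewrite -radiusE; have := radius_gt0; have := eta_gt0; nra.
Qed.

Lemma radius_ge : 83 / 5 * (D * L) <= radius.
Proof.
have h1 := eta_gt0; have h2 := eta_le; have r0 := radius_gt0; have e := radiusE.
have : radius * (6 * eta) <= radius * (1 / 100) by rewrite ler_pM2l //; lra.
lra.
Qed.

End Constants.

(** * Analysis of an epoch *)

Section QuadraticObjective.
Variables (R : realType) (d : nat) (beta eta : R).
Hypotheses (d0 : (0 < d)%N) (eta0 : 0 < eta).
Implicit Types (X Y A Q V : 'M[R[i]]_d) (G : nat -> 'M[R[i]]_d).

Lemma is_argmin_ext (F1 F2 : 'M[R[i]]_d -> \bar R) X :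
  F1 =1 F2 -> is_argmin F1 X -> is_argmin F2 X.
Proof. by move=> e [dX hX]; split=> // Y dY; rewrite -!e; apply: hX. Qed.

Lemma inner_segment X Y A (t : R) :
  inner (X + t%:C *: (Y - X)) A = inner X A + t * (inner Y A - inner X A).
Proof. by rewrite innerDl innerZl innerBl. Qed.

Lemma quad_segment (y z t : R) :
  quad beta (y + t * (z - y)) = quad beta y +
    t * (- (1 + beta - beta * y) * (z - y)) + t ^+ 2 * (beta / 2 * (z - y) ^+ 2).
Proof. by rewrite /quad; field. Qed.

(** Derivative of the [objective] below at [X] in the direction Y - X. *)
Definition slope G m Q X Y : R :=
  \sum_(1 <= s < m.+1) - (1 + beta - beta * inner X (G s)) *
    (inner Y (G s) - inner X (G s)) - (inner Y Q - inner X Q).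

(** Common shape of both cumulative objectives: [Q] is 0 for the surrogate minimizers and B (P_m -
    P_0) for the played points; [K] collects the losses at the played points. *)
Definition objective (K : R) G m Q X : R :=
  K + \sum_(1 <= s < m.+1) quad beta (inner X (G s)) - inner X Q.

Lemma objective_segment K G m Q X Y t :
  objective K G m Q (X + t%:C *: (Y - X)) = objective K G m Q X +
    t * slope G m Q X Y + t ^+ 2 *
    \sum_(1 <= s < m.+1) beta / 2 * (inner Y (G s) - inner X (G s)) ^+ 2.
Proof.
rewrite /objective inner_segment.
have -> : \sum_(1 <= s < m.+1) quad beta (inner (X + t%:C *: (Y - X)) (G s)) =
   \sum_(1 <= s < m.+1) quad beta (inner X (G s)) +
   t * \sum_(1 <= s < m.+1) - (1 + beta - beta * inner X (G s)) *
    (inner Y (G s) - inner X (G s)) + t ^+ 2 *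
    \sum_(1 <= s < m.+1) beta / 2 * (inner Y (G s) - inner X (G s)) ^+ 2.
  rewrite !mulr_sumr -!big_split; apply: eq_bigr => s _ /=.
  by rewrite inner_segment quad_segment.
rewrite /slope; move: (\sum_(_ <= _ < _) _) (\sum_(_ <= _ < _) _) => p q.
by move: (\sum_(_ <= _ < _) _) (inner _ _) (inner _ _) => r u v; ring.
Qed.

Lemma argmin_slope K G m Q X Y :
  is_argmin (fun V => (objective K G m Q V)%:E + (eta^-1)%:E * logdet_reg V)%E X ->
  pdmx Y -> density Y -> inner (invmx X) Y - d%:R <= eta * slope G m Q X Y.
Proof.
move=> hX pY dY; apply: (argmin_first_order d0 eta0 hX pY dY) => t.
exact: objective_segment.
Qed.

Lemma objective_full K G m Q X Y :
  objective K G m Q Y = objective K G m Q X + slope G m Q X Y +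
    \sum_(1 <= s < m.+1) beta / 2 * (inner Y (G s) - inner X (G s)) ^+ 2.
Proof.
have := objective_segment K G m Q X Y 1.
by rewrite scale1r addrC subrK mul1r expr1n mul1r.
Qed.

(** Makes the first iterate, a minimizer of the regularizer alone, the case of zero rounds of the
    general pattern. *)
Lemma argmin0 G Q X : Q = 0 -> is_argmin (@logdet_reg R d) X ->
  is_argmin (fun V => (objective 0 G 0 Q V)%:E + (eta^-1)%:E * logdet_reg V)%E X.
Proof.
move=> -> [dX hX]; split=> // Y dY.
rewrite /objective !big_geq // !inner0r !subr0 addr0 !add0e.
by rewrite lee_pmul2l ?lte_fin ?invr_gt0// hX.
Qed.

Lemma surrogate_quad A X V : inner X A != 0 ->
  surrogate beta A X V =
  loss A X + quad beta (inner V ((inner X A)^-1%:C *: A)).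
Proof.
move=> a0; rewrite /surrogate /grad_loss /quad scaleNr innerNr !innerZr innerBl.
by rewrite addrA; field.
Qed.

End QuadraticObjective.

Section Epoch.
Variables (R : realType) (d T : nat) (B eta beta : R).
Hypotheses (d1 : (1 <= d)%N) (hT : (110 * d ^ 2 <= T)%N).
Hypothesis hB : B = 264 / 5 * d%:R ^+ 2 * ln (T%:R : R).
Hypothesis heta : eta = 1 / (4 * B).
Hypothesis hbeta : beta = 11 * d%:R / (7 * B).
Variables (Rs : nat -> 'M[R[i]]_d) (e : epoch R d).
Hypothesis ve : valid_epoch B eta beta Rs e.
Hypothesis dens : forall s, (1 <= s <= len e)%N -> density (Rs (start e + s)%N).
Hypothesis lenT : (len e <= T)%N.

Local Notation X := (epX e).
Local Notation U := (epU e).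
Local Notation P := (epP e).
Local Notation L := (ln (T%:R : R)).
Local Notation D := (d%:R : R).

(* [inner V (ratio_mx s)] is the ratio <V, R_s> / <X_s, R_s>, through which both
   the loss and its surrogate depend on [V]. *)
Definition ratio_mx s : 'M[R[i]]_d :=
  ((inner (X s) (Rs (start e + s)%N))^-1)%:C *: Rs (start e + s)%N.
Local Notation G := ratio_mx.

Definition incr s : 'M[R[i]]_d := P s - P s.-1.

Let eta0 := eta_gt0 d1 hT hB heta.
Let beta0 := beta_gt0 d1 hT hB hbeta.

Definition loss_sum m : R :=
  \sum_(1 <= s < m.+1) loss (Rs (start e + s)%N) (X s).

Lemma pdX s : (1 <= s <= (len e).+1)%N -> pdmx (X s).
Proof.
case: s => [//|[_|s hs]].
  exact: (argmin_pd d1 eta0 (argmin0 beta eta0 (fun=> 0) erefl (epoch_X1 ve))).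
exact: (argmin_pd d1 eta0 (epoch_X ve (tau := s.+1) hs)).
Qed.

Lemma densX s : (1 <= s <= (len e).+1)%N -> density (X s).
Proof.
case: s => [//|[_|s hs]]; first by case: (epoch_X1 ve).
by case: (epoch_X ve (tau := s.+1) hs).
Qed.

Lemma pdU s : (1 <= s <= (len e).+1)%N -> pdmx (U s).
Proof.
case: s => [//|[_|s hs]]; first by rewrite (epoch_U1 ve); apply: pdX.
exact: (argmin_pd d1 eta0 (epoch_U ve (tau := s.+1) hs)).
Qed.

Lemma densU s : (1 <= s <= (len e).+1)%N -> density (U s).
Proof.
case: s => [//|[_|s hs]]; first by rewrite (epoch_U1 ve); apply: densX.
by case: (epoch_U ve (tau := s.+1) hs).
Qed.

Lemma tr_density (A : 'M[R[i]]_d) : density A -> inner A 1%:M = 1.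
Proof. by case=> _ tA; rewrite inner1r tA. Qed.

Lemma inner_pd_density (A M : 'M[R[i]]_d) : pdmx A -> density M -> 0 < inner A M.
Proof.
move=> pA [pM tM]; have h := inner_invl_ge pA pM.
rewrite tr_density // in h; have h0 := inner_ge0 (pd_psd pA) pM.
rewrite lt_neqAle h0 andbT eq_sym; apply/eqP => h1.
by rewrite h1 mulr0 ler10 in h.
Qed.

Lemma inner_loss_gt0 s : (1 <= s <= len e)%N ->
  0 < inner (X s) (Rs (start e + s)%N).
Proof.
move=> hs; apply: inner_pd_density (dens hs).
by apply: pdX; case/andP: hs => -> /= /leqW.
Qed.

Lemma psdG s : (1 <= s <= len e)%N -> psdmx (G s).
Proof.
move=> hs; apply: psdZ; first by rewrite invr_ge0 ltW // inner_loss_gt0.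
by case: (dens hs).
Qed.

Lemma innerXG s : (1 <= s <= len e)%N -> inner (X s) (G s) = 1.
Proof. by move=> hs; rewrite innerZr mulVf // gt_eqF // inner_loss_gt0. Qed.

Lemma sum_incr m V : \sum_(1 <= s < m.+1) B * inner V (incr s) =
  inner V (B%:C *: (P m - P 0%N)).
Proof.
rewrite innerZr -mulr_sumr; congr (_ * _).
elim: m => [|m IH]; first by rewrite big_geq // subrr inner0r.
by rewrite big_nat_recr //= IH -innerDr /incr addrC addrA subrK.
Qed.

Lemma surrogate_sum m V : (m <= len e)%N ->
  \sum_(1 <= s < m.+1) surrogate beta (Rs (start e + s)%N) (X s) V =
  objective beta (loss_sum m) G m 0 V.
Proof.
move=> hm; rewrite /objective inner0r subr0 -big_split /=.
apply: eq_big_nat => s /andP[s1 s2].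
rewrite surrogate_quad // gt_eqF // inner_loss_gt0 // s1.
by rewrite (leq_trans _ hm).
Qed.

Lemma biased_sum m V : (m <= len e)%N ->
  \sum_(1 <= s < m.+1) biased_surrogate B beta (Rs (start e + s)%N) (X s)
     (P s.-1) (P s) V =
  objective beta (loss_sum m) G m (B%:C *: (P m - P 0%N)) V.
Proof.
move=> hm; rewrite sumrB surrogate_sum // sum_incr.
by rewrite /objective inner0r subr0.
Qed.

Lemma argX m : (m <= len e)%N ->
  is_argmin (fun V => (objective beta (if m == 0%N then 0 else loss_sum m) G m
    (B%:C *: (P m - P 0%N)) V)%:E + (eta^-1)%:E * logdet_reg V)%E (X m.+1).
Proof.
case: m => [_|m hm].
  apply: (argmin0 beta eta0 G _ (epoch_X1 ve)).
  by rewrite subrr scaler0.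
have := epoch_X ve (tau := m.+1) hm.
by apply: is_argmin_ext => V; rewrite biased_sum.
Qed.

Lemma argU m : (m <= len e)%N ->
  is_argmin (fun V => (objective beta (if m == 0%N then 0 else loss_sum m) G m
    0 V)%:E + (eta^-1)%:E * logdet_reg V)%E (U m.+1).
Proof.
case: m => [_|m hm].
  by rewrite (epoch_U1 ve); apply: (argmin0 beta eta0 G erefl (epoch_X1 ve)).
have := epoch_U ve (tau := m.+1) hm.
by apply: is_argmin_ext => V; rewrite surrogate_sum.
Qed.

(** * Optimality conditions of consecutive minimizers *)

Lemma slopeX m Y : (m <= len e)%N -> pdmx Y -> density Y ->
  inner (invmx (X m.+1)) Y - D <=
  eta * slope beta G m (B%:C *: (P m - P 0%N)) (X m.+1) Y.
Proof. by move=> hm; apply: (argmin_slope d1 eta0 (argX hm)). Qed.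

Lemma slopeU m Y : (m <= len e)%N -> pdmx Y -> density Y ->
  inner (invmx (U m.+1)) Y - D <= eta * slope beta G m 0 (U m.+1) Y.
Proof. by move=> hm; apply: (argmin_slope d1 eta0 (argU hm)). Qed.

(** On the common rounds the linear parts of the two slopes cancel and leave squares with
    coefficient - beta; besides them only the slope of the new round and the change of bias
    remain. *)
Lemma symdiv_slope m Q Q' V Y :
  slope beta G m Q V Y + slope beta G m.+1 Q' Y V =
  - beta * \sum_(1 <= s < m.+1) (inner Y (G s) - inner V (G s)) ^+ 2 +
  (1 + beta - beta * inner Y (G m.+1)) * (inner Y (G m.+1) - inner V (G m.+1)) +
  (inner Y Q' - inner V Q' - (inner Y Q - inner V Q)).
Proof.
rewrite /slope (big_nat_recr m.+1) //= mulr_sumr.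
have -> : \sum_(1 <= s < m.+1) - (1 + beta - beta * inner V (G s)) *
    (inner Y (G s) - inner V (G s)) =
  \sum_(1 <= s < m.+1) - beta * (inner Y (G s) - inner V (G s)) ^+ 2
  - \sum_(1 <= s < m.+1) - (1 + beta - beta * inner Y (G s)) *
    (inner V (G s) - inner Y (G s)).
  by rewrite -sumrB; apply: eq_bigr => s _; ring.
move: (\sum_(_ <= _ < _) _) (\sum_(_ <= _ < _) _) => p q; ring.
Qed.

(** * Bias matrices and stability of the played points *)

Lemma P0E : P 0%N = D%:C%:M.
Proof. by rewrite (epoch_P0 ve) -(rmorph_nat (real_complex R) d). Qed.

Lemma pdP0 : pdmx (P 0%N).
Proof. by rewrite P0E; apply: pd_scalar; rewrite ltr0n. Qed.

Lemma pdP s : (s <= (len e).+1)%N -> pdmx (P s).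
Proof.
elim: s => [_|s IH hs]; first exact: pdP0.
have pP := IH (ltnW hs).
have [pD _ _] := update_P_spec (pdX (s := s.+1) hs) (pd_adj pP).
rewrite (epoch_P ve (tau := s.+1) hs) /=.
by have := pdDr pP pD; rewrite addrC subrK.
Qed.

Lemma P_spec s : (1 <= s <= (len e).+1)%N ->
  [/\ psdmx (incr s), loewner_le (invmx (X s)) (P s) &
      P s *m X s *m incr s = incr s].
Proof.
move=> hs; rewrite /incr (epoch_P ve hs); apply: update_P_spec; first exact: pdX.
apply/pd_adj/pdP; case/andP: hs => _; exact: leq_trans (leq_pred s).
Qed.

Lemma P_mono r s : (r <= s <= (len e).+1)%N -> loewner_le (P r) (P s).
Proof.
case/andP; elim: s => [|s IH].
  by rewrite leqn0 => /eqP -> _; apply: loewner_refl.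
rewrite leq_eqVlt => /predU1P[-> _|hr hs]; first exact: loewner_refl.
apply: (loewner_trans (IH hr (ltnW hs))).
by have [] := P_spec (s := s.+1) hs.
Qed.

(** The optimality conditions of the two points are added; the squares coming from the surrogates
    have a negative sign and are dropped. The coefficient 1/4 is [eta * B]. *)
Lemma symdivX s : (1 <= s <= len e)%N ->
  symdiv (X s) (X s.+1) <=
  eta * (inner (X s.+1) (G s) - 1) +
  1 / 4 * (inner (X s.+1) (incr s) - inner (X s) (incr s)).
Proof.
case: s => [//|m] hm; have hm' : (m <= len e)%N by apply: ltnW.
have h1 := slopeX hm' (pdX (s := m.+2) hm) (densX (s := m.+2) hm).
have h2 := slopeX (m := m.+1) hm (pdX (s := m.+1) hm') (densX (s := m.+1) hm').
have h3 := symdiv_slope m (B%:C *: (P m - P 0%N)) (B%:C *: (P m.+1 - P 0%N))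
  (X m.+1) (X m.+2).
have hG := innerXG (s := m.+1) hm.
have hQ : inner (X m.+2) (B%:C *: (P m.+1 - P 0%N)) -
    inner (X m.+1) (B%:C *: (P m.+1 - P 0%N)) -
    (inner (X m.+2) (B%:C *: (P m - P 0%N)) -
     inner (X m.+1) (B%:C *: (P m - P 0%N))) =
    B * (inner (X m.+2) (incr m.+1) - inner (X m.+1) (incr m.+1)).
  rewrite !innerZr /incr /= !innerBr.
  move: (inner (X m.+2) (P m.+1)) (inner (X m.+2) (P m)) (inner _ (P 0%N)).
  move: (inner _ (P m.+1)) (inner _ (P m)) (inner _ (P 0%N)) => a b c u v w.
  ring.
rewrite hQ hG in h3.
have s0 : 0 <= beta * \sum_(1 <= s < m.+1)
    (inner (X m.+2) (G s) - inner (X m.+1) (G s)) ^+ 2.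
  apply: mulr_ge0; first exact: ltW.
  by apply: sumr_ge0 => s _; apply: sqr_ge0.
rewrite /symdiv -[1 / 4](etaB d1 hT hB heta).
move: h1 h2 h3 s0 => {hQ hG hm hm'}.
move: (slope _ _ _ _ _ _) (slope _ _ _ _ _ _) (\sum_(_ <= _ < _) _).
move: (inner _ (G m.+1)) (inner (X m.+2) (incr _)) (inner (X m.+1) (incr _)).
move: (inner _ (X m.+1)) (inner _ (X m.+2)) => i2 i1 g p q s1 s2 sq h1 h2 h3 s0.
have h4 := mulr_ge0 (ltW beta0) (sqr_ge0 (g - 1)).
have h5 : eta * (s1 + s2) <= eta * ((g - 1) + B * (p - q)).
  by rewrite ler_pM2l //; lra.
lra.
Qed.

(* The squared Frobenius norm of [X_s^(1/2) (P_s - P_(s-1)) X_s^(1/2)]. *)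
Definition frob s := inner (X s *m incr s *m X s) (incr s).

(** With S^2 the divergence, [near_inner] and [near_frob] bound the right-hand side of [symdivX] by
    (eta + 2 eta / 4) S (1 + S); dividing by S gives S <= 3/2 eta (1 + S). *)
Lemma symdiv_small s : (1 <= s <= len e)%N -> frob s <= (2 * eta) ^+ 2 ->
  symdiv (X s) (X s.+1) <= (8 / 5 * eta) ^+ 2.
Proof.
move=> hs hf.
have hs1 : (1 <= s <= (len e).+1)%N by case/andP: hs => -> /= /leqW.
have hs2 : (1 <= s.+1 <= (len e).+1)%N by case/andP: hs.
have pV := pdX hs1; have pY := pdX hs2.
have h := symdivX hs.
have e0 : 0 <= 2 * eta by rewrite mulr_ge0 // ltW.
have [pD _ _] := P_spec hs1.
have S0 := sqrtr_ge0 (symdiv (X s) (X s.+1)).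
have eS : symdiv (X s) (X s.+1) = Num.sqrt (symdiv (X s) (X s.+1)) ^+ 2.
  by rewrite sqr_sqrtr // symdiv_ge0.
move: S0 eS; move: (Num.sqrt _) => S S0 eS.
have hS : symdiv (X s) (X s.+1) <= S ^+ 2 by rewrite eS.
have h1 := near_inner pV pY (psdG hs) S0 hS.
have h2 := near_frob pV pY (psd_adj pD) S0 e0 hS hf.
rewrite (innerXG hs) mulr1 ler_norml in h1; case/andP: h1 => _ h1.
rewrite {}eS {hS hf pD} in h *.
move: h h1 h2; have := eta_le d1 hT hB heta.
move: (inner (X s.+1) (G s)) (inner (X s.+1) (incr s)) (inner (X s) (incr s)).
move=> g p q he h h1 h2.
rewrite ler_pXn2r ?nnegrE // ?mulr_ge0 //; last exact: ltW.
have h3 : S ^+ 2 <= 3 / 2 * eta * (S * (1 + S)) by have := eta0; nra.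
move: S0; rewrite le_eqVlt => /predU1P[<-|S0]; first by rewrite mulr_ge0 // ltW.
have h4 : S <= 3 / 2 * eta * (1 + S).
  by rewrite -(ler_pM2l S0) -expr2 mulrCA.
have := eta0; nra.
Qed.

(** P_0 is the inverse of the uniform matrix, and the optimality of X_1 tested against that matrix
    gives divergence 0; [update_frob] then applies with S = 0. *)
Lemma frob1 : frob 1 <= 0.
Proof.
have h1 : (1 <= 1 <= (len e).+1)%N by [].
have [pD _ eD] := P_spec h1; have D0 : 0 < D by rewrite ltr0n.
have DV : 0 < D^-1 by rewrite invr_gt0.
have pW := pd_scalar d DV.
have hs : symdiv (D^-1%:C%:M) (X 1%N) <= 0 ^+ 2.
  have := slopeX (m := 0) isT pW (density_uniform R d1).
  rewrite /slope big_geq // subrr !innerZr !inner0r mulr0 !subr0 mulr0.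
  rewrite /symdiv invmx_scalarR // invrK (inner_scalarl D).
  rewrite (tr_density (densX h1)) mulr1 expr0n /=.
  by move: (inner _ _) => p; lra.
have := update_frob (P := P 0%N) (D := incr 1%N) pW (pdX h1) pD _ _ (lexx 0) hs.
rewrite mul0r expr0n /=; apply; last by rewrite /incr addrC subrK.
by rewrite (invmx_scalarR d DV) invrK P0E; apply: loewner_refl.
Qed.

(** Two estimates alternate: a small increment makes the next step short ([symdiv_small]), and a
    short step makes the next increment small ([update_frob]). The loop closes because 8/5 eta (1 +
    8/5 eta) <= 2 eta. *)
Lemma frob_le s : (1 <= s <= (len e).+1)%N -> frob s <= (2 * eta) ^+ 2.
Proof.
case: s => [//|]; elim=> [_|s IH hs].
  by apply: le_trans frob1 _; rewrite sqr_ge0.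
have hs' : (1 <= s.+1 <= (len e).+1)%N by apply: ltnW.
have hS := symdiv_small (s := s.+1) hs (IH hs').
have [pD _ eD] := P_spec (s := s.+2) hs.
have [_ le1 _] := P_spec hs'.
have e0 : 0 <= 8 / 5 * eta by rewrite mulr_ge0 // ltW.
have eD' : (P s.+1 + incr s.+2) *m X s.+2 *m incr s.+2 = incr s.+2.
  by rewrite /incr /= [P s.+1 + _]addrC subrK.
apply: le_trans (update_frob (pdX hs') (pdX (s := s.+2) hs) pD le1 eD' e0 hS) _.
have := eta_le d1 hT hB heta; have := eta0 => e1 e2.
rewrite ler_pXn2r ?nnegrE ?mulr_ge0 ?addr_ge0 //; try exact: ltW.
nra.
Qed.

Lemma symdivX_le s : (1 <= s <= len e)%N ->
  symdiv (X s) (X s.+1) <= (8 / 5 * eta) ^+ 2.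
Proof.
move=> hs; apply: symdiv_small => //; apply: frob_le.
by case/andP: hs => -> /= /leqW.
Qed.

(** * Stability of the surrogate minimizers *)

Local Notation radius := (radius eta beta).
Let r0 := radius_gt0 d1 hT hB heta hbeta.

Lemma innerX1P1_le : inner (X 1%N) (P 1%N) <= D.
Proof.
have h1 : (1 <= 1 <= (len e).+1)%N by [].
have [pD _ _] := P_spec h1.
have hf : frob 1 <= 0 ^+ 2 by rewrite expr0n /= frob1.
have := inner_le_frob (pdX h1) (psd_adj pD) (lexx 0) hf.
rewrite mulr0 /incr innerBr /= subr_le0 => /le_trans -> //.
by rewrite innerC P0E (inner_scalarl D) (tr_density (densX h1)) mulr1.
Qed.

Lemma U_lt_P s : (1 <= s <= len e)%N ->
  loewner_lt (U s) (radius%:C *: invmx (P s)).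
Proof.
case: s => [//|[_|s hs]].
  (* No reset test precedes internal time 1, so here the bound comes from <U_1, P_1> <= d, which is
     below the radius. At later times it is the untriggered test of the previous internal time. *)
  have h1 : (1 <= 1 <= (len e).+1)%N by [].
  rewrite (epoch_U1 ve); apply: (psd_inner_lt (pdP (s := 1%N) isT) (pd_psd (pdX h1))).
  apply: le_lt_trans innerX1P1_le _.
  apply: lt_le_trans (radius_ge d1 hT hB heta hbeta).
  have := ln_horizon_ge3 R d1 hT; have := dim_ge1 R d1; nra.
by have /contrapT := epoch_no_early_reset ve (tau := s.+1) hs.
Qed.

(** This is what the bias matrices achieve: P_s >= P_r >= X_r^-1, so U_s <= radius P_s^-1 <= radius
    X_r for all rounds r up to s, while <X_r, G_r> = 1. *)
Lemma innerUG_le r s : (1 <= r <= s)%N -> (s <= len e)%N ->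
  inner (U s) (G r) <= radius.
Proof.
case/andP=> hr hrs hs.
have hs1 : (1 <= s <= len e)%N by rewrite (leq_trans hr hrs) hs.
have hrn : (1 <= r <= len e)%N by rewrite hr (leq_trans hrs).
have hrn1 : (1 <= r <= (len e).+1)%N by rewrite hr (leqW (leq_trans hrs hs)).
have pG := psdG hrn; have pXr := pdX hrn1.
have pPs := pdP (leqW hs).
have h1 := inner_mono pG (pd_psd (U_lt_P hs1)).
have [_ h2 _] := P_spec hrn1.
have h3 : loewner_le (invmx (X r)) (P s).
  by apply: (loewner_trans h2); apply: P_mono; rewrite hrs (leqW hs).
have h4 := inner_mono pG (loewner_leV (pd_inv pXr) pPs h3).
rewrite invmxK (innerXG hrn) in h4; rewrite innerZl in h1.
apply: le_trans h1 _; rewrite -[leRHS]mulr1.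
by rewrite ler_pM2l.
Qed.

Lemma innerUG_ge0 r s : (1 <= r <= len e)%N -> (1 <= s <= (len e).+1)%N ->
  0 <= inner (U s) (G r).
Proof. by move=> hr hs; apply: inner_ge0 (pd_psd (pdU hs)) (psdG hr). Qed.

Lemma symdivU s : (1 <= s <= len e)%N ->
  symdiv (U s) (U s.+1) <=
  eta * ((1 + beta - beta * inner (U s) (G s)) *
    (inner (U s.+1) (G s) - inner (U s) (G s))).
Proof.
case: s => [//|m] hm; have hm' : (m <= len e)%N by apply: ltnW.
have h1 := slopeU hm' (pdU (s := m.+2) hm) (densU (s := m.+2) hm).
have h2 := slopeU (m := m.+1) hm (pdU (s := m.+1) hm') (densU (s := m.+1) hm').
have h3 := symdiv_slope m 0 0 (U m.+1) (U m.+2).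
rewrite !inner0r !subr0 addr0 in h3.
have s0 : 0 <= beta * \sum_(1 <= s < m.+1)
    (inner (U m.+2) (G s) - inner (U m.+1) (G s)) ^+ 2.
  apply: mulr_ge0; first exact: ltW.
  by apply: sumr_ge0 => s _; apply: sqr_ge0.
rewrite /symdiv.
move: h1 h2 h3 s0 => {hm hm'}.
move: (slope _ _ _ _ _ _) (slope _ _ _ _ _ _) (\sum_(_ <= _ < _) _).
move: (inner (U m.+1) (G m.+1)) (inner (U m.+2) (G m.+1)).
move: (inner _ (U m.+1)) (inner _ (U m.+2)) => i2 i1 z z' s1 s2 sq h1 h2 h3 s0.
have h4 := mulr_ge0 (ltW beta0) (sqr_ge0 (z' - z)).
have h5 : eta * (s1 + s2) <= eta * ((1 + beta - beta * z) * (z' - z)).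
  by rewrite ler_pM2l //; lra.
lra.
Qed.

(** 4 x (c - x) <= c^2 with x = beta z and c = 1 + beta. *)
Lemma slope_term_le z : 4 * beta * ((1 + beta - beta * z) * z) <= (1 + beta) ^+ 2.
Proof.
rewrite -subr_ge0 (_ : _ - _ = (1 + beta - 2 * (beta * z)) ^+ 2) ?sqr_ge0 //.
by ring.
Qed.

(** As for the played points, S^2 is the divergence and satisfies S^2 <= q S (1 + S), now with q =
    eta (1 + beta - beta z) z <= 1/20 by [slope_term_le] and [eta_quad]. *)
Lemma symdivU_le s : (1 <= s <= len e)%N ->
  symdiv (U s) (U s.+1) <= (1 / 19) ^+ 2.
Proof.
move=> hs.
have hs1 : (1 <= s <= (len e).+1)%N by case/andP: hs => -> /= /leqW.
have hs2 : (1 <= s.+1 <= (len e).+1)%N by case/andP: hs.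
have pV := pdU hs1; have pY := pdU hs2.
have h := symdivU hs.
have S0 := sqrtr_ge0 (symdiv (U s) (U s.+1)).
have eS : symdiv (U s) (U s.+1) = Num.sqrt (symdiv (U s) (U s.+1)) ^+ 2.
  by rewrite sqr_sqrtr // symdiv_ge0.
move: S0 eS; move: (Num.sqrt _) => S S0 eS.
have hS : symdiv (U s) (U s.+1) <= S ^+ 2 by rewrite eS.
have h1 := near_inner pV pY (psdG hs) S0 hS.
rewrite ler_norml in h1; case/andP: h1 => _ h1.
rewrite {}eS {hS} in h *.
have z0 := innerUG_ge0 hs hs1.
have z1 : inner (U s) (G s) <= radius.
  by case/andP: hs => s1 s2; apply: innerUG_le => //; rewrite s1 leqnn.
have hbr := beta_radius d1 hT hB heta hbeta.
have hq := eta_quad d1 hT hB heta hbeta.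
have hD := dim_ge1 R d1.
move: h h1 z0 z1; move: (inner (U s) (G s)) (inner (U s.+1) (G s)) => z z' h h1 z0 z1.
have hz := slope_term_le z.
have bz : beta * z <= 1 / 2 by apply: le_trans hbr; rewrite ler_pM2l.
have w0 : 0 <= 1 + beta - beta * z by have := beta0; lra.
have h2 : S ^+ 2 <= eta * ((1 + beta - beta * z) * (S * (1 + S) * z)).
  by apply: (le_trans h); rewrite ler_pM2l // ler_wpM2l.
have q1 : eta * ((1 + beta - beta * z) * z) <= 1 / 20.
  rewrite -(ler_pM2l (_ : 0 < 80 * beta)) ?mulr_gt0 //.
  have e1 : eta * (4 * beta * ((1 + beta - beta * z) * z)) <= eta * (1 + beta) ^+ 2.
    by rewrite ler_pM2l.
  have e2 : eta * (1 + beta) ^+ 2 <= eta * D * (1 + beta) ^+ 2.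
    by rewrite ler_wpM2r ?sqr_ge0 // ler_peMr // ltW.
  lra.
rewrite ler_pXn2r ?nnegrE ?divr_ge0 //.
move: S0; rewrite le_eqVlt => /predU1P[<-|S0]; first by rewrite divr_ge0.
have h3 : S <= 1 / 20 * (1 + S).
  rewrite -(ler_pM2l S0); apply: (@le_trans _ _ (S * (1 + S) * (1 / 20))); last lra.
  apply: (@le_trans _ _ (S * (1 + S) * (eta * ((1 + beta - beta * z) * z)))); first lra.
  by rewrite ler_pM2l // mulr_gt0 //; lra.
lra.
Qed.

(** The last minimizer may be the one that triggers the reset, so the bound 1/2 is taken from its
    predecessor and carried over by one step of stability. *)
Lemma innerhatUG_le r : (1 <= r <= len e)%N ->
  beta * inner (U (len e).+1) (G r) <= 11 / 20.
Proof.
move=> hr; have ln0 := epoch_len_gt0 ve.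
have hn : (1 <= len e <= len e)%N by rewrite ln0 leqnn.
have hn1 : (1 <= len e <= (len e).+1)%N by rewrite ln0 leqnSn.
have hn2 : (1 <= (len e).+1 <= (len e).+1)%N by rewrite leqnn.
have S0 : 0 <= 1 / 19 :> R by rewrite divr_ge0.
have := near_inner (pdU hn1) (pdU hn2) (psdG hr) S0 (symdivU_le hn).
rewrite ler_norml => /andP[_].
have : inner (U (len e)) (G r) <= radius by apply: innerUG_le.
have hbr := beta_radius d1 hT hB heta hbeta.
move: (inner (U (len e)) (G r)) (inner (U (len e).+1) (G r)) => z z' h1 h2.
have : beta * z <= 1 / 2 by apply: le_trans hbr; rewrite ler_pM2l.
have : beta * (z' - z) <= beta * (1 / 19 * (1 + 1 / 19) * z) by rewrite ler_pM2l.
lra.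
Qed.

(** * A priori bounds polynomial in the horizon *)

Lemma sum_nat_const (m : nat) (x : R) : \sum_(1 <= s < m.+1) x = m%:R * x.
Proof. by rewrite sumr_const_nat subn1 mulr_natl. Qed.

(** Optimality of U_s tested at the uniform matrix bounds tr U_s^-1 by d^2 plus eta d times a slope,
    to which each round contributes at most (1 + beta - beta z) z. The two parts are at most T/110
    and T/20. *)
Lemma invU_le s : (1 <= s <= len e)%N ->
  inner (invmx (U s)) 1%:M <= T%:R / 16.
Proof.
case: s => [//|m] hm; have hm' : (m <= len e)%N by apply: ltnW.
have D0 : 0 < D by rewrite ltr0n.
have DV : 0 < D^-1 by rewrite invr_gt0.
have h := slopeU hm' (pd_scalar d DV) (density_uniform R d1).
rewrite innerC inner_scalarl in h.
have hs : 4 * beta * slope beta G m 0 (U m.+1) (D^-1%:C%:M) <=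
    m%:R * (1 + beta) ^+ 2.
  rewrite /slope !inner0r !subr0 mulr_sumr -(sum_nat_const m ((1 + beta) ^+ 2)).
  apply: ler_sum_nat => r /andP[r1 r2].
  have hr : (1 <= r <= len e)%N by rewrite r1 (leq_trans _ hm').
  have z0 : 0 <= inner (D^-1%:C%:M) (G r).
    exact: inner_ge0 (pd_psd (pd_scalar d DV)) (psdG hr).
  have z1 : inner (U m.+1) (G r) <= radius.
    by apply: innerUG_le; rewrite ?r1 //= ltnW.
  move: z0 z1; move: (inner (U m.+1) _) (inner _ (G r)) => z y y0 z1.
  have bz : beta * z <= 1 / 2.
    apply: le_trans (beta_radius d1 hT hB heta hbeta).
    by rewrite ler_pM2l.
  have w0 : 0 <= beta * ((1 + beta - beta * z) * y).
    by rewrite !mulr_ge0 //; have := beta0; lra.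
  have := slope_term_le z; lra.
have mT : m%:R <= T%:R :> R by rewrite ler_nat (leq_trans hm').
have hq := eta_quad d1 hT hB heta hbeta; have hT' := horizon_ge_dim R hT.
move: h hs; move: (inner _ _) (slope _ _ _ _ _ _) => I s h hs.
have h1 : I <= D ^+ 2 + eta * D * s.
  have -> : I = D * (D^-1 * I) by rewrite mulrA divff ?mul1r // gt_eqF.
  have : D * (D^-1 * I - D) <= D * (eta * s) by rewrite ler_pM2l.
  lra.
have h2 : 4 * beta * (eta * D * s) <= 4 * beta * (T%:R / 20).
  have eD : 0 <= eta * D by rewrite mulr_ge0 // ltW.
  have e1 : eta * D * (4 * beta * s) <= eta * D * (m%:R * (1 + beta) ^+ 2).
    by rewrite ler_wpM2l.
  have e2 : m%:R * (20 * (eta * D * (1 + beta) ^+ 2)) <= T%:R * (4 * beta).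
    apply: ler_pM => //.
    by rewrite !mulr_ge0 ?exprn_ge0 // ?addr_ge0 // ltW.
  lra.
rewrite ler_pM2l ?mulr_gt0 // in h2; have T0 := horizon_gt0 R d1 hT.
lra.
Qed.

Lemma traceP_le s : (1 <= s <= len e)%N -> inner (P s) 1%:M <= radius * (T%:R / 16).
Proof.
move=> hs; have hs1 : (1 <= s <= (len e).+1)%N by case/andP: hs => -> /= /leqW.
have hs2 : (s <= (len e).+1)%N by case/andP: hs1.
have h := loewner_lt_swap r0 (pdP hs2) (pdU hs1) (U_lt_P hs).
apply: le_trans (inner_mono (pd_psd (@pd1 R d)) h) _.
by rewrite innerZl ler_pM2l // invU_le.
Qed.

(** Crude powers of T suffice from here on, because these bounds enter the regret only through
    logarithms. *)
Lemma radius_le_horizon : radius * (T%:R / 16) <= D * T%:R ^+ 2.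
Proof.
have h1 := radius_le d1 hT hB heta hbeta; have h2 := ln_horizon_le R d1 hT.
have D1 := dim_ge1 R d1; have T0 := horizon_gt0 R d1 hT.
have h3 : radius <= 84 / 5 * (D * (T%:R / 2)).
  by apply: le_trans h1 _; rewrite ler_pM2l // ler_pM2l //; lra.
apply: (@le_trans _ _ (84 / 5 * (D * (T%:R / 2)) * (T%:R / 16))).
  by rewrite ler_pM2r // divr_gt0.
rewrite expr2; have : 0 <= D * (T%:R * T%:R) by rewrite !mulr_ge0 // ltW.
lra.
Qed.

Lemma inner_invX_le s : (1 <= s <= len e)%N ->
  inner (invmx (X s)) 1%:M <= T%:R ^+ 3.
Proof.
move=> hs; have hs1 : (1 <= s <= (len e).+1)%N by case/andP: hs => -> /= /leqW.
have [_ h _] := P_spec hs1.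
apply: le_trans (inner_mono (pd_psd (@pd1 R d)) h) _.
apply: le_trans (traceP_le hs) _; apply: le_trans radius_le_horizon _.
rewrite [leRHS]exprS ler_wpM2r ?exprn_ge0 // ler_nat.
by apply: leq_trans hT; rewrite -mulnn mulnA -{1}[d]mul1n leq_mul // muln_gt0.
Qed.

Lemma inner_density_le1 (A : 'M[R[i]]_d) : density A -> inner A A <= 1.
Proof.
move=> dA; case: (dA) => pA tA; have := inner_mono pA (psd_le_tr pA).
by rewrite tA (inner_scalarl 1) (tr_density dA) mulr1.
Qed.

Lemma innerGG_le s : (1 <= s <= len e)%N -> inner (G s) (G s) <= T%:R ^+ 6.
Proof.
move=> hs; have a0 := inner_loss_gt0 hs; have dA := dens hs.
have hs1 : (1 <= s <= (len e).+1)%N by case/andP: hs => -> /= /leqW.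
have h := inner_invl_ge (pdX hs1) (proj1 dA).
rewrite (tr_density dA) in h; rewrite /ratio_mx innerZl innerZr.
have h1 := inner_density_le1 dA.
have h2 : (inner (X s) (Rs (start e + s)%N))^-1 <= T%:R ^+ 3.
  apply: le_trans (inner_invX_le hs).
  by rewrite -[X in X <= _]mul1r ler_pdivrMr.
have v0 : 0 < (inner (X s) (Rs (start e + s)%N))^-1 by rewrite invr_gt0.
have g0 := inner_ge0 (proj1 dA) (proj1 dA).
move: h1 h2 v0 g0; move: (_^-1) (inner _ _) => v g h1 h2 v0 g0.
rewrite (exprD _ 3 3); apply: ler_pM; [exact: ltW| |exact: h2|].
  by rewrite mulr_ge0 // ltW.
apply: le_trans h2; by rewrite ler_piMr // ltW.
Qed.

(** Tangent of log det at T^2 times the identity, with tr P <= d T^2. *)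
Lemma ldP_le : ld (P (len e)) <= 2 * (D * L).
Proof.
have hn : (1 <= len e <= len e)%N by rewrite (epoch_len_gt0 ve) leqnn.
have T0 := horizon_gt0 R d1 hT.
have := ld_le_scalar (exprn_gt0 2 T0) (pdP (leqnSn (len e))).
rewrite lnXn // -[L *+ 2]mulr_natl.
have : inner (P (len e)) 1%:M / T%:R ^+ 2 <= D.
  rewrite ler_pdivrMr ?exprn_gt0 //.
  exact: le_trans (traceP_le hn) radius_le_horizon.
move: (ld _) (_ / _) => p q; lra.
Qed.

(** * Follow-the-regularized-leader bound for the played points *)

Lemma ldP0_ge0 : 0 <= ld (P 0%N).
Proof.
have D0 : 0 < D by rewrite ltr0n.
by rewrite P0E ld_scalar // mulr_ge0 ?ler0n // ln_ge0 // ler1n.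
Qed.

(** By complementary slackness P_s^-1 and X_s have the same inner product with the increment P_s -
    P_(s-1), so the tangent of log det at P_s charges each bias term to the growth of log det P. *)
Lemma sum_X_incr m : (m <= (len e).+1)%N ->
  \sum_(1 <= s < m.+1) inner (X s) (incr s) <= ld (P m) - ld (P 0%N).
Proof.
elim: m => [|m IH] hm; first by rewrite big_geq // subrr.
rewrite big_nat_recr //=; have pP := pdP hm; have pP' := pdP (ltnW hm).
have h := ld_le pP pP'; have [_ _ eD] := P_spec (s := m.+1) hm.
have e1 : inner (invmx (P m.+1)) (P m) = D - inner (X m.+1) (incr m.+1).
  rewrite -(inner_invl pP) /inner.
  have -> : P m = P m.+1 - incr m.+1 by rewrite /incr opprB addrC subrK.
  rewrite -[in P m.+1 - _]eD -/(inner _ _) innerBr -/(inner _ _).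
  congr (_ - _); rewrite /inner.
  by rewrite -mulmxA (mulKmx (pd_unit pP)).
rewrite e1 in h; have := IH (ltnW hm).
move: (\sum_(_ <= _ < _) _) (inner _ _) (ld _) (ld _) (ld _) h => S q l l0 l1; lra.
Qed.

(** Up to a constant, the regularized objective that X_(m+1) minimizes. *)
Definition potential m V : R :=
  objective beta 0 G m (B%:C *: (P m - P 0%N)) V - eta^-1 * ld V.

Lemma objective_recr m V : objective beta 0 G m.+1 (B%:C *: (P m.+1 - P 0%N)) V =
  objective beta 0 G m (B%:C *: (P m - P 0%N)) V + quad beta (inner V (G m.+1)) -
  B * inner V (incr m.+1).
Proof.
rewrite /objective big_nat_recr //= /incr !innerZr !innerBr /=.
move: (\sum_(_ <= _ < _) _) (quad _ _) => p q.
move: (inner V (P m.+1)) (inner V (P m)) (inner V _) => u v w; ring.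
Qed.

Local Notation step_mx s := (X s.+1 - X s).

(* [1/5 |X_(s+1) - X_s|^2] bounds the Bregman divergence of the regularizer from
   below because [X_s <= 1]. *)
Definition gain s : R :=
  inner (step_mx s) (G s) - 1 / 2 * (2 / (5 * eta) *
    inner (step_mx s) (step_mx s) +
    beta * \sum_(1 <= r < s.+1) inner (step_mx s) (G r) ^+ 2).

(** The objective is expanded around its minimizer X_(m+1): the slope, bounded by optimality, and
    the log-determinants combine into 1/eta times a Bregman divergence, which yields the Frobenius
    term of [gain]. The bias at the new point is at most 11/10 of that at the old one by
    [near_inner]. *)
Lemma stability_step m : (m < len e)%N ->
  potential m (X m.+1) - potential m.+1 (X m.+2) <=
  gain m.+1 + 11 / 10 * B * inner (X m.+1) (incr m.+1).
Proof.
move=> hm; have hm' : (m <= len e)%N := ltnW hm.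
have pV := pdX (s := m.+1) hm'; have pY := pdX (s := m.+2) hm.
have e0 : 0 <= 8 / 5 * eta by rewrite mulr_ge0 // ltW.
have e1 : 8 / 5 * eta <= 1 / 100 by have := eta_le d1 hT hB heta; lra.
have hS := symdivX_le (s := m.+1) hm.
have [_ tV] := densX (s := m.+1) hm'.
have tV' : complex.Re (\tr (X m.+1)) = 1 by rewrite tV.
have h1 := bregman_frob pV pY tV' e0 e1 hS.
have h2 := slopeX hm' pY (densX (s := m.+2) hm).
have h3 := objective_full beta 0 G m (B%:C *: (P m - P 0%N)) (X m.+1) (X m.+2).
have [pD _ _] := P_spec (s := m.+1) hm'.
have h4 := near_inner pV pY pD e0 hS.
rewrite ler_norml in h4; case/andP: h4 => _ h4.
have h5 := inner_ge0 (pd_psd pV) pD.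
have h6 : inner (X m.+2) (incr m.+1) <= 11 / 10 * inner (X m.+1) (incr m.+1).
  move: h4 h5 e0 e1; move: (inner (X m.+1) _) (inner (X m.+2) _) (_ * eta).
  move=> p q s h4 h5 e0 e1.
  have h6 : s * (1 + s) <= 1 / 10 by nra.
  by have := ler_wpM2r h5 h6; lra.
have h7 : B * inner (X m.+2) (incr m.+1) <=
    11 / 10 * B * inner (X m.+1) (incr m.+1).
  by rewrite [11 / 10 * B]mulrC -mulrA ler_pM2l // (bias_gt0 d1 hT hB).
rewrite /gain /potential objective_recr h3.
rewrite [\sum_(_ <= _ < m.+2) _]big_nat_recr //=.
rewrite (innerBl (X m.+2) (X m.+1) (G m.+1)) (innerXG (s := m.+1) hm).
have -> : \sum_(1 <= r < m.+1) inner (step_mx m.+1) (G r) ^+ 2 =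
    \sum_(1 <= r < m.+1) (inner (X m.+2) (G r) - inner (X m.+1) (G r)) ^+ 2.
  by apply: eq_bigr => r _; rewrite innerBl.
rewrite -mulr_sumr.
move: h1 h2 h7 {h3 h4 h5 h6 tV tV' hS pD pV pY hm hm'}.
move: (inner (step_mx m.+1) (step_mx m.+1)) (slope _ _ _ _ _ _).
move: (\sum_(_ <= _ < _) _) (inner (X m.+2) (G _)) (objective _ _ _ _ _ _).
move: (ld (X m.+2)) (ld (X m.+1)) (B * _) (11 / 10 * B * _) (inner (invmx _) _).
move=> lY lV b1 b2 I q g f F s h1 h2 h7.
have h8 : eta^-1 * (1 / 5 * F) <= s + eta^-1 * (lV - lY).
  rewrite -(ler_pM2l eta0) mulrDr !(mulrA eta eta^-1) divff ?gt_eqF // !mul1r.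
  lra.
have -> : 2 / (5 * eta) = 2 / 5 * eta^-1 by field; rewrite gt_eqF.
rewrite /quad; move: (eta^-1) h8 => v h8; lra.
Qed.

Lemma stability m : (m <= len e)%N ->
  potential 0 (X 1%N) - potential m (X m.+1) <=
  \sum_(1 <= s < m.+1) gain s +
  11 / 10 * B * \sum_(1 <= s < m.+1) inner (X s) (incr s).
Proof.
elim: m => [|m IH] hm; first by rewrite !big_geq // subrr mulr0 addr0.
have -> : potential 0 (X 1%N) - potential m.+1 (X m.+2) =
    potential 0 (X 1%N) - potential m (X m.+1) +
    (potential m (X m.+1) - potential m.+1 (X m.+2)) by rewrite addrA subrK.
apply: le_trans (lerD (IH (ltnW hm)) (stability_step hm)) _.
rewrite [leRHS](_ : _ = \sum_(1 <= s < m.+1) gain s + gain m.+1 + 11 / 10 * B *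
  (\sum_(1 <= s < m.+1) inner (X s) (incr s) + inner (X m.+1) (incr m.+1))).
  by rewrite mulrDr addrACA.
by rewrite -!big_nat_recr.
Qed.

Lemma elliptic_bound :
  \sum_(1 <= s < (len e).+1) gain s <=
  49 / 22 * (B * (D * L)).
Proof.
have T0 := horizon_gt0 R d1 hT; have T1 := horizon_ge110 R d1 hT; have D1 := dim_ge1 R d1.
pose a := 2 / (5 * eta); have a0 : 0 < a by rewrite divr_gt0 // mulr_gt0.
(* The Gram matrix has trace at most d^2 a + beta T^7, so this [t] makes the trace term harmless and
   leaves ln t - ln a = 7 ln T. *)
pose t := a * T%:R ^+ 7; have t0 : 0 < t by rewrite mulr_gt0 // exprn_gt0.
have hX s : (1 <= s)%N -> (s <= len e)%N -> (step_mx s)^t* = step_mx s.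
  move=> s1 s2; rewrite adjD adjN (pd_adj (pdX (s := s.+1) s2)).
  by rewrite (pd_adj (pdX (s := s) _)) // s1 leqW.
have hG r : (1 <= r <= len e)%N -> (G r)^t* = G r by move=> hr; apply/psd_adj/psdG.
have key := @elliptic_potential R (d * d) a beta (fun r => mxvec (G r)) a0 beta0
  (len e) (fun s => mxvec (step_mx s)) (fun s r => inner (step_mx s) (G r)) t t0.
have hc s r : (1 <= r <= s)%N -> (s <= len e)%N ->
    (mxvec (step_mx s) *m (mxvec (G r))^t*) 0 0 = (inner (step_mx s) (G r))%:C.
  case/andP=> r1 rs sn; apply: mxvec_inner; last by rewrite hG // r1 (leq_trans rs).
  by apply: hX => //; apply: leq_trans rs.
have {}key := key hc.
have e1 : \sum_(1 <= s < (len e).+1) (inner (step_mx s) (G s) - 1 / 2 * (a *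
     complex.Re ((mxvec (step_mx s) *m (mxvec (step_mx s))^t*) 0 0) +
     beta * \sum_(1 <= r < s.+1) inner (step_mx s) (G r) ^+ 2)) =
  \sum_(1 <= s < (len e).+1) gain s.
  apply: eq_big_nat => s /andP[s1 s2]; have h := hX s s1 s2.
  by rewrite (mxvec_inner h h).
rewrite e1 in key; apply: le_trans key _.
have e2 : \sum_(1 <= r < (len e).+1) complex.Re ((mxvec (G r) *m (mxvec (G r))^t*) 0 0)
    <= T%:R ^+ 7.
  apply: (@le_trans _ _ (\sum_(1 <= r < (len e).+1) T%:R ^+ 6)).
    apply: ler_sum_nat => r hr; have h := hG r hr.
    by rewrite (mxvec_inner h h) innerGG_le.
  by rewrite sum_nat_const exprS ler_wpM2r ?exprn_ge0 // ler_nat.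
have e3 : ln t - ln a = 7 * L.
  rewrite /t lnM ?posrE ?exprn_gt0 // lnXn // -[L *+ 7]mulr_natl; ring.
rewrite e3.
have N1 : 1 <= (d * d)%:R :> R by rewrite ler1n muln_gt0 d1.
have a1 : 2 * beta <= a.
  have := beta_le d1 hT hB hbeta; have := eta_le d1 hT hB heta => he hb.
  have : 2 <= a by rewrite /a ler_pdivlMr ?mulr_gt0 //; lra.
  lra.
have T7 : 2 <= T%:R ^+ 7 :> R.
  apply: le_trans (_ : T%:R <= _); first lra.
  by rewrite -{1}[T%:R]expr1 ler_weXn2l //; lra.
have e4 : ((d * d)%:R * a + beta * \sum_(1 <= r < (len e).+1)
    complex.Re ((mxvec (G r) *m (mxvec (G r))^t*) 0 0)) / t - (d * d)%:R <= 0.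
  rewrite subr_le0 ler_pdivrMr // /t.
  move: e2 N1 a1 T7; move: (\sum_(_ <= _ < _) _) ((d * d)%:R : R) (T%:R ^+ 7).
  move=> S N t7 e2 N1 a1 T7.
  have Na : 0 <= N * a by rewrite mulr_ge0 //; lra.
  have h1 : N * a * 2 <= N * a * t7 by rewrite ler_wpM2l.
  have h2 : beta * S <= beta * t7 by rewrite ler_pM2l.
  have h3 : 2 * beta * t7 <= N * a * t7.
    rewrite ler_wpM2r //; first lra.
    by apply: le_trans a1 _; rewrite ler_peMl // ltW.
  lra.
apply: (@le_trans _ _ ((2 * beta)^-1 * ((d * d)%:R * (7 * L)))).
  by rewrite ler_pM2l ?invr_gt0 ?mulr_gt0 //; lra.
rewrite mulrC ler_pdivrMr ?mulr_gt0 // natrM.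
have := betaB d1 hT hB hbeta; move: (d%:R : R) L => D' L' h.
(* 7 d^2 ln T / (2 beta) equals 49/22 B d ln T because 7 beta B = 11 d. *)
have -> : 49 / 22 * (B * (D' * L')) * (2 * beta) =
   7 / 11 * (7 * (beta * B)) * (D' * L') by field.
by rewrite h le_eqVlt; apply/orP; left; apply/eqP; field.
Qed.

(** * Regret bounds for one epoch *)

Local Notation hatU := (U (len e).+1).

Lemma loss_diff_le s (W : 'M[R[i]]_d) : pdmx W -> (1 <= s <= len e)%N ->
  loss (Rs (start e + s)%N) (X s) - loss (Rs (start e + s)%N) W <=
  - quad beta (inner hatU (G s)) - - (1 + beta - beta * inner hatU (G s)) *
    (inner W (G s) - inner hatU (G s)).
Proof.
move=> pW hs; have a0 := inner_loss_gt0 hs.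
have w0 := inner_pd_density pW (dens hs).
have hz : inner W (G s) = inner W (Rs (start e + s)%N) / inner (X s) (Rs (start e + s)%N).
  by rewrite innerZr mulrC.
have z0 : 0 < inner W (G s) by rewrite hz divr_gt0.
rewrite /loss opprK addrC -ln_div ?posrE // -hz mulNr opprK.
apply: ln_le_tangent z0 _ (innerhatUG_le hs) => //.
  exact: beta_le d1 hT hB hbeta.
by apply: innerUG_ge0 => //; rewrite leqnn.
Qed.

(** Summing the tangent bounds leaves minus the slope at [hatU] towards [W]. By optimality this
    slope is at least 1/eta times <hatU^-1, W> - d, hence by concavity at least 1/eta times ld W -
    ld hatU. *)
Lemma regret_le_surrogate (W : 'M[R[i]]_d) : pdmx W -> density W ->
  epoch_regret Rs e W <= eta^-1 * (ld hatU - ld W) -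
    \sum_(1 <= s < (len e).+1) quad beta (inner hatU (G s)).
Proof.
move=> pW dW; have hn2 : (1 <= (len e).+1 <= (len e).+1)%N by rewrite leqnn.
apply: (@le_trans _ _ (- slope beta G (len e) 0 hatU W -
    \sum_(1 <= s < (len e).+1) quad beta (inner hatU (G s)))).
  rewrite /slope !inner0r !subr0 [leRHS]addrC -!sumrN -big_split /=.
  by apply: ler_sum_nat => s hs; apply: loss_diff_le.
rewrite lerD2r -[leLHS]mul1r -(mulVf (lt0r_neq0 eta0)) -mulrA ler_pM2l ?invr_gt0 //.
have := slopeU (leqnn (len e)) pW dW; have := ld_le (pdU hn2) pW.
by move: (ld _) (ld _) (inner _ _) (slope _ _ _ _ _ _) => p q r s h1 h2; lra.
Qed.

(** The final played point minimizes the biased objective and is compared with [hatU]; the bias at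
    [hatU] survives with a negative sign and later pays for a reset. *)
Lemma potential_hatU :
  eta^-1 * ld hatU - \sum_(1 <= s < (len e).+1) quad beta (inner hatU (G s)) <=
  - potential (len e) (X (len e).+1) -
    inner hatU (B%:C *: (P (len e) - P 0%N)).
Proof.
have hn2 : (1 <= (len e).+1 <= (len e).+1)%N by rewrite leqnn.
have [_ /(_ _ (densU hn2))] := argX (leqnn (len e)).
rewrite (logdet_reg_pd (pdX hn2)) (logdet_reg_pd (pdU hn2)) -!EFinM -!EFinD lee_fin.
move: (if _ then _ else _) => K.
have e1 V : objective beta K G (len e) (B%:C *: (P (len e) - P 0%N)) V =
  K + objective beta 0 G (len e) (B%:C *: (P (len e) - P 0%N)) V.
  by rewrite /objective add0r addrA.
have e2 : objective beta 0 G (len e) (B%:C *: (P (len e) - P 0%N)) hatU =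
  \sum_(1 <= s < (len e).+1) quad beta (inner hatU (G s)) -
  inner hatU (B%:C *: (P (len e) - P 0%N)) by rewrite /objective add0r.
rewrite !e1 e2 /potential.
move: (objective _ _ _ _ _ _) (ld (X _)) (ld hatU) (inner hatU _) => o l l' i.
move: (\sum_(_ <= _ < _) _) (eta^-1) => S v; lra.
Qed.

(** Tangent of log det at [W] evaluated at 1/T times the identity, with W^-1 at most T times the
    identity. *)
Lemma ld_comparator (W : 'M[R[i]]_d) :
  pdmx W -> loewner_le ((T%:R : R)^-1)%:C%:M W ->
  - (D * L) <= ld W.
Proof.
move=> pW hW; have T0 := horizon_gt0 R d1 hT.
have TV : 0 < (T%:R : R)^-1 by rewrite invr_gt0.
have h := ld_le pW (pd_scalar d TV).
have h2 := inner_mono (pd_psd (@pd1 R d)) (loewner_leV (pd_scalar d TV) pW hW).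
have e1 : inner (1%:M : 'M[R[i]]_d) 1%:M = D.
  by rewrite inner1r mxtrace1 -(rmorph_nat (real_complex R) d).
rewrite (invmx_scalarR d TV) invrK (inner_scalarl T%:R) e1 in h2.
rewrite ld_scalar // innerC inner_scalarl innerC lnV ?posrE // in h.
have h3 : T%:R^-1 * inner (invmx W) 1%:M <= D by rewrite mulrC ler_pdivrMr // mulrC.
move: h h3; rewrite [inner 1%:M _]innerC.
move: (ld W) (_ * inner _ _) => p q h h3; lra.
Qed.

Lemma ldX1_le0 : ld (X 1%N) <= 0.
Proof.
have h := ld_le_scalar ltr01 (pdX (s := 1%N) isT).
rewrite ln1 mulr0 add0r divr1 (tr_density (densX (s := 1%N) isT)) in h.
by apply: le_trans h _; rewrite subr_le0 ler1n.
Qed.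

Lemma regret_le (W : 'M[R[i]]_d) :
  pdmx W -> density W -> loewner_le ((T%:R : R)^-1)%:C%:M W ->
  epoch_regret Rs e W <=
  49 / 22 * (B * (D * L)) + 11 / 5 * (B * (D * L)) + 4 * (B * (D * L)) + B * D -
  B * inner hatU (P (len e)).
Proof.
move=> pW dW hW; have hn2 : (1 <= (len e).+1 <= (len e).+1)%N by rewrite leqnn.
have h10 : 0 <= potential 0 (X 1%N).
  rewrite /potential /objective big_geq // subrr innerZr inner0r mulr0 !subr0 addr0.
  rewrite add0r -mulrN; apply: mulr_ge0; first by rewrite invr_ge0 ltW.
  by rewrite oppr_ge0 ldX1_le0.
have h11 : inner hatU (B%:C *: (P (len e) - P 0%N)) =
    B * inner hatU (P (len e)) - B * D.
  rewrite innerZr innerBr mulrBr; congr (_ - _ * _).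
  by rewrite innerC P0E (inner_scalarl D) (tr_density (densU hn2)) mulr1.
have h1 := regret_le_surrogate pW dW; have h2 := potential_hatU.
rewrite h11 in h2; rewrite (eta_inv heta) in h1 h2.
exact: regret_combine (bias_gt0 d1 hT hB) h1 h2 (stability (leqnn (len e)))
  elliptic_bound (sum_X_incr (leqnSn (len e))) ldP_le ldP0_ge0
  (ld_comparator pW hW) h10.
Qed.

(** The regret bound contains P_len, while the reset test uses P_(len+1). Their difference is at
    most 2 eta X_(len+1)^-1 <= 2 eta P_(len+1) by [inner_le_frob_inv] and [frob_le], and 2 eta <=
    1/300. *)
Lemma reset_radius_le : ends_with_reset eta beta e ->
  9 / 10 * radius <= inner hatU (P (len e)).
Proof.
have hn2 : (1 <= (len e).+1 <= (len e).+1)%N by rewrite leqnn.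
move=> hr; have pU' := pd_psd (pdU hn2); have pP' := pdP (leqnn (len e).+1).
have h1 : radius <= inner hatU (P (len e).+1).
  by rewrite leNgt; apply/negP => h; apply: hr; apply: (psd_inner_lt pP' pU' h).
have [pD hle _] := P_spec hn2.
have e0 : 0 <= 2 * eta by rewrite mulr_ge0 // ltW.
have h2 := inner_le_frob_inv (pdX hn2) (psd_adj pD) pU' e0 (frob_le hn2).
have h3 := inner_mono pU' hle.
rewrite innerC /incr innerBr /= in h2; rewrite [inner (P _) _]innerC in h3.
have he := eta_le d1 hT hB heta; have e0' := eta0.
have hi := inner_ge0 (pd_psd (pd_inv (pdX hn2))) pU'.
move: h1 h2 h3 hi r0; move: radius => c.
move: (inner hatU (P (len e).+1)) (inner hatU (P (len e))) (inner (invmx _) _).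
move=> p q i h1 h2 h3 hi c0.
have h4 : 2 * eta * i <= 1 / 300 * p.
  by apply: ler_pM => //; lra.
lra.
Qed.

Lemma regret_reset (W : 'M[R[i]]_d) :
  pdmx W -> density W -> loewner_le ((T%:R : R)^-1)%:C%:M W ->
  ends_with_reset eta beta e -> epoch_regret Rs e W <= 0.
Proof.
move=> pW dW hW hr; apply: le_trans (regret_le pW dW hW) _.
have B0 := bias_gt0 d1 hT hB; have D1 := dim_ge1 R d1; have L3 := ln_horizon_ge3 R d1 hT.
have h1 := reset_radius_le hr; have h2 := radius_ge d1 hT hB heta hbeta.
(* In units of B d ln T, the positive terms are at most 49/22 + 11/5 + 4 + 1/3, below 9, against the
   negative 9/10 times 83/5, above 14. *)
have h3 : B * (9 / 10 * (83 / 5 * (D * L))) <= B * inner hatU (P (len e)).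
  by rewrite ler_pM2l //; apply: le_trans h1; rewrite ler_pM2l // divr_gt0.
have h4 : B * D * 3 <= B * D * L by rewrite ler_pM2l // mulr_gt0 //; lra.
move: h3; move: (inner hatU _) => p h3.
have h5 : 0 <= B * D by rewrite mulr_ge0 //; lra.
lra.
Qed.

Lemma regret_last (W : 'M[R[i]]_d) :
  pdmx W -> density W -> loewner_le ((T%:R : R)^-1)%:C%:M W ->
  epoch_regret Rs e W <= 528 * D ^+ 3 * L ^+ 2.
Proof.
move=> pW dW hW; apply: le_trans (regret_le pW dW hW) _.
have hn2 : (1 <= (len e).+1 <= (len e).+1)%N by rewrite leqnn.
have h := inner_ge0 (pd_psd (pdU hn2)) (pd_psd (pdP (leqnSn (len e)))).
have B0 := bias_gt0 d1 hT hB; have D1 := dim_ge1 R d1; have L3 := ln_horizon_ge3 R d1 hT.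
have h3 : 0 <= B * inner hatU (P (len e)) by rewrite mulr_ge0 // ltW.
have h4 : B * D * 3 <= B * D * L by rewrite ler_pM2l // mulr_gt0 //; lra.
have h5 : 0 <= B * D by rewrite mulr_ge0 //; lra.
(* The positive terms stay below 10 B d ln T, and 528 is 10 times 264/5. *)
rewrite (_ : 528 * D ^+ 3 * L ^+ 2 = 10 * (B * (D * L))).
  move: h3; move: (inner hatU _) => p h3; lra.
by rewrite hB; field.
Qed.

End Epoch.

(** Induction downward from the last epoch, which ends with round T; every other epoch ends where
    its successor starts. *)
Lemma run_end_le (R : realType) (d T : nat) (B eta beta : R)
    (Rs : nat -> 'M[R[i]]_d) (n : nat) (E : nat -> epoch R d) :
  bisons_run T B eta beta Rs n E ->
  forall k, (k <= n)%N -> (start (E k) + len (E k) <= T)%N.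
Proof.
move=> run; have key j k : (k + j)%N = n -> (start (E k) + len (E k) <= T)%N.
  elim: j k => [|j IH] k; first by rewrite addn0 => ->; rewrite (run_end run).
  rewrite addnS -addSn => kj; have kn : (k < n)%N by rewrite -kj leq_addr.
  have [_ <-] := run_next run kn.
  by apply: leq_trans (IH _ kj); apply: leq_addr.
by move=> k kn; apply: (key (n - k)%N); apply: subnKC.
Qed.

Theorem theorem4 (R : realType) :
  exists C : R, 0 < C /\
  forall (d T : nat), (1 <= d)%N -> (110 * d ^ 2 <= T)%N ->
  forall (B eta beta : R),
    B = 264 / 5 * d%:R ^+ 2 * ln (T%:R : R) ->
    eta = 1 / (4 * B) ->
    beta = 11 * d%:R / (7 * B) ->
  forall (Rs : nat -> 'M[R[i]]_d),
    (forall t : nat, (1 <= t <= T)%N -> density (Rs t)) ->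
  forall (n : nat) (E : nat -> epoch R d),
    bisons_run T B eta beta Rs n E ->
  forall U : 'M[R[i]]_d,
    density U -> loewner_le ((T%:R : R)^-1)%:C%:M U ->
    (forall k : nat, (k <= n)%N -> ends_with_reset eta beta (E k) ->
       epoch_regret Rs (E k) U <= 0) /\
    (~ ends_with_reset eta beta (E n) ->
       epoch_regret Rs (E n) U <= C * d%:R ^+ 3 * ln (T%:R : R) ^+ 2).
Proof.
exists 528; split; first by rewrite ltr0n.
move=> d T d1 hT B eta beta hB heta hbeta Rs dR n E run U dU hU.
have pU : pdmx U.
  have TV : 0 < (T%:R : R)^-1 by rewrite invr_gt0 (horizon_gt0 R d1 hT).
  by have := pdDr (pd_scalar d TV) hU; rewrite addrC subrK.
have hend := run_end_le run.
have dens k : (k <= n)%N ->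
    forall s, (1 <= s <= len (E k))%N -> density (Rs (start (E k) + s)%N).
  move=> kn s /andP[s1 s2]; apply: dR; rewrite addn_gt0 s1 orbT /=.
  by apply: leq_trans (hend k kn); rewrite leq_add2l.
have lenT k : (k <= n)%N -> (len (E k) <= T)%N.
  by move=> kn; apply: leq_trans (hend k kn); apply: leq_addl.
split=> [k kn hr|_].
  exact: (regret_reset d1 hT hB heta hbeta (run_valid run kn) (dens k kn)
    (lenT k kn) pU dU hU hr).
exact: (regret_last d1 hT hB heta hbeta (run_valid run (leqnn n))
  (dens n (leqnn n)) (lenT n (leqnn n)) pU dU hU).
Qed.
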